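(* Let $1\le p,q_1,q_2\le\infty$ and $\alpha_1,\alpha_2\ge0$. The inclusion $B^{\alpha_1}_{p,q_1}(\gamma_d)\subset B^{\alpha_2}_{p,q_2}(\gamma_d)$ holds if either (i) $\alpha_1>\alpha_2>0$ ($q_1$ and $q_2$ need not be related), or (ii) $\alpha_1=\alpha_2$ and $q_1\le q_2$.
   Context: $\gamma_d$ is the Gaussian probability measure on $\mathbb{R}^d$ with density $\pi^{-d/2}e^{-|x|^2}$, and $\|\cdot\|_{p,\gamma_d}$ is the norm of $L^p(\gamma_d)$. Ornstein-Uhlenbeck semigroup: $T_tf(x)=\pi^{-d/2}(1-e^{-2t})^{-d/2}\int_{\mathbb{R}^d}e^{-|y-e^{-t}x|^2/(1-e^{-2t})}f(y)\,dy$ for $t>0$, $T_0f=f$. Poisson-Hermite semigroup: $P_tf(x)=\int_0^\infty T_sf(x)\,\mu_t^{(1/2)}(ds)$ for $t>0$, where $\mu^{(1/2)}_t(ds)=\frac{t}{2\sqrt{\pi}}\frac{e^{-t^2/4s}}{s^{3/2}}ds$ on $(0,\infty)$; $P_0f=f$. Gaussian Besov-Lipschitz spaces: let $\alpha\ge0$, $k$ the smallest integer greater than $\alpha$, $1\le p,q\le\infty$. For $q<\infty$, $B^{\alpha}_{p,q}(\gamma_d)$ is the set of $f\in L^p(\gamma_d)$ with $\left(\int_0^\infty\left(t^{k-\alpha}\left\|\frac{\partial^kP_tf}{\partial t^k}\right\|_{p,\gamma_d}\right)^q\frac{dt}{t}\right)^{1/q}<\infty$. For $q=\infty$, $B^{\alpha}_{p,\infty}(\gamma_d)$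 is the set of $f\in L^p(\gamma_d)$ for which there is a constant $A$ with $\left\|\frac{\partial^kP_tf}{\partial t^k}\right\|_{p,\gamma_d}\le At^{-k+\alpha}$ for all $t>0$. *)

(* Defs.v *)
From HB Require Import structures.
From mathcomp Require Import all_boot all_order all_algebra.
From mathcomp Require Import all_classical all_reals all_analysis.
From mathcomp Require Import measurable_realfun.

Set Implicit Arguments.
Unset Strict Implicit.
Unset Printing Implicit Defensive.

Import Order.TTheory GRing.Theory Num.Theory.
Import numFieldNormedType.Exports.

Local Open Scope classical_set_scope.
Local Open Scope ring_scope.

(* R^d is d.-tuple R: the sigma-algebra the library puts on it is generated by
   the coordinate maps, i.e., it is the Borel sigma-algebra of R^d. *)

Section lebesgue_step.
Context {R : realType} (n : nat).
Variable m : {sigma_finite_measure set (n.-tuple R) -> \bar R}.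

Definition tuple_cons (x : R * n.-tuple R) : n.+1.-tuple R :=
  [tuple of x.1 :: x.2].

Definition tuple_uncons (t : n.+1.-tuple R) : R * n.-tuple R :=
  (thead t, [tuple of behead t]).

Lemma measurable_tuple_cons : measurable_fun [set: R * n.-tuple R] tuple_cons.
Proof. exact: measurable_cons. Qed.

Lemma measurable_tuple_uncons :
  measurable_fun [set: n.+1.-tuple R] tuple_uncons.
Proof.
apply/measurable_fun_pairP; split.
  exact: (measurable_tnth (ord0 : 'I_n.+1)).
exact: measurable_behead.
Qed.

Lemma tuple_consK : cancel tuple_cons tuple_uncons.
Proof. by move=> [a t]; congr pair; exact: val_inj. Qed.

Definition lebesgue_step : set (n.+1.-tuple R) -> \bar R :=
  pushforward (@lebesgue_measure R \x m)%E tuple_cons.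

Let mpre (A : set (n.+1.-tuple R)) :
  measurable A -> measurable (tuple_cons @^-1` A).
Proof.
by move=> mA; rewrite -[X in measurable X]setTI; exact: measurable_tuple_cons.
Qed.

Let lebesgue_step0 : lebesgue_step set0 = 0%E.
Proof. by rewrite /lebesgue_step /pushforward preimage_set0 measure0. Qed.

Let lebesgue_step_ge0 A : (0 <= lebesgue_step A)%E.
Proof. by rewrite /lebesgue_step /pushforward; exact: measure_ge0. Qed.

Let lebesgue_step_sigma_additive : semi_sigma_additive lebesgue_step.
Proof.
move=> F mF tF mUF; rewrite /lebesgue_step /pushforward preimage_bigcup.
apply: measure_semi_sigma_additive.
- by move=> i; exact: mpre.
- apply/trivIsetP => /= i j _ _ ij; rewrite -preimage_setI.
  by move/trivIsetP : tF => /(_ _ _ _ _ ij) ->//; rewrite preimage_set0.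
- by rewrite -preimage_bigcup; exact: mpre.
Qed.

HB.instance Definition _ := isMeasure.Build _ _ _ lebesgue_step
  lebesgue_step0 lebesgue_step_ge0 lebesgue_step_sigma_additive.

Let lebesgue_step_sigma_finite : sigma_finite setT lebesgue_step.
Proof.
have /sigma_finiteP[F [TF ndF Foo]] := sigma_finiteT (@lebesgue_measure R).
have /sigma_finiteP[G [TG ndG Goo]] := sigma_finiteT m.
have mcons i : tuple_cons @^-1` (tuple_uncons @^-1` (F i `*` G i)) =
    F i `*` G i.
  by rewrite -comp_preimage (_ : _ \o _ = id)//; apply/funext => x;
    exact: tuple_consK.
exists (fun i => tuple_uncons @^-1` (F i `*` G i)).
  rewrite -preimage_bigcup predeqE => t; split=> // _.
  have [i _ Fi] : (\bigcup_i F i) (tuple_uncons t).1 by rewrite -TF.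
  have [j _ Gj] : (\bigcup_i G i) (tuple_uncons t).2 by rewrite -TG.
  exists (maxn i j) => //; split.
  - by move: Fi; exact/subsetPset/ndF/leq_maxl.
  - by move: Gj; exact/subsetPset/ndG/leq_maxr.
move=> i; have [mF Fi] := Foo i; have [mG Gi] := Goo i; split.
  rewrite -[X in measurable X]setTI; apply: measurable_tuple_uncons => //.
  exact: measurableX.
rewrite /lebesgue_step /pushforward mcons product_measure1E//.
by rewrite lte_mul_pinfty// ge0_fin_numE.
Qed.

HB.instance Definition _ := Measure_isSigmaFinite.Build _ _ _ lebesgue_step
  lebesgue_step_sigma_finite.

End lebesgue_step.

(* Lebesgue measure on the Borel sets of R^d: the image of the product of
   lebesgue_measure and lebesgue_tuple R d.-1 under (a, t) |-> a :: t. *)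
Fixpoint lebesgue_tuple (R : realType) (d : nat) :
    {sigma_finite_measure set (d.-tuple R) -> \bar R} :=
  match d with
  | 0 => \d_([tuple] : 0.-tuple R)
  | d'.+1 => lebesgue_step (lebesgue_tuple R d')
  end.

Section gaussian_measure.
Context {R : realType} (d : nat).
Implicit Types x y : d.-tuple R.

Definition sqnorm x : R := \sum_(i < d) tnth x i ^+ 2.

Definition gauss_density x : R := pi `^ (- (d%:R / 2)) * expR (- sqnorm x).

Lemma gauss_density_ge0 x : 0 <= gauss_density x.
Proof. by rewrite mulr_ge0 ?powR_ge0 ?expR_ge0. Qed.

Lemma measurable_gauss_density : measurable_fun setT gauss_density.
Proof.
apply: measurable_funM => //; apply: measurableT_comp => //.
apply: measurableT_comp => //; apply: measurable_sum => i.
by apply: measurable_funX; exact: measurable_tnth.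
Qed.

Definition gaussian : set (d.-tuple R) -> \bar R :=
  fun A => (\int[lebesgue_tuple R d]_(x in A) (gauss_density x)%:E)%E.

Let gaussian0 : gaussian set0 = 0%E.
Proof. by rewrite /gaussian integral_set0. Qed.

Let gaussian_ge0 A : (0 <= gaussian A)%E.
Proof. by apply: integral_ge0 => x _; rewrite lee_fin gauss_density_ge0. Qed.

Let gaussian_sigma_additive : semi_sigma_additive gaussian.
Proof.
move=> F mF tF mUF; rewrite /gaussian ge0_integral_bigcup//=; last 2 first.
- apply/measurable_EFinP; apply: measurable_funTS.
  exact: measurable_gauss_density.
- by move=> x _; rewrite lee_fin gauss_density_ge0.
apply: is_cvg_ereal_nneg_natsum_cond => i _ _.
by apply: integral_ge0 => x _; rewrite lee_fin gauss_density_ge0.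
Qed.

HB.instance Definition _ := isMeasure.Build _ _ _ gaussian
  gaussian0 gaussian_ge0 gaussian_sigma_additive.

End gaussian_measure.

Arguments gaussian : clear implicits.

Section besov.
Context {R : realType} (d : nat).
Implicit Types (f : d.-tuple R -> R) (x y : d.-tuple R) (p q : \bar R).

(* |y - c x|^2 *)
Definition sqdist_scaled (c : R) x y : R :=
  \sum_(i < d) (tnth y i - c * tnth x i) ^+ 2.

(* ornstein_uhlenbeck and poisson_hermite are only meaningful for t >= 0; the
   values at t < 0 do not affect the derivatives at t > 0 used below. *)
Definition ornstein_uhlenbeck (t : R) f x : R :=
  if t == 0 then f x else
  pi `^ (- (d%:R / 2)) * (1 - expR (- (2 * t))) `^ (- (d%:R / 2)) *
  \int[lebesgue_tuple R d]_y
    (expR (- (sqdist_scaled (expR (- t)) x y / (1 - expR (- (2 * t))))) * f y).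

(* mu_t^(1/2)(ds) = stable_density t s ds on (0, +oo), for t > 0 *)
Definition stable_density (t s : R) : R :=
  t / (2 * Num.sqrt pi) * (expR (- (t ^+ 2 / (4 * s))) / s `^ (3 / 2)).

Definition poisson_hermite (t : R) f x : R :=
  if t == 0 then f x else
  \int[@lebesgue_measure R]_(s in `]0, +oo[)
    (ornstein_uhlenbeck s f x * stable_density t s).

Definition poisson_hermite_deriv (k : nat) f (t : R) x : R :=
  derive1n k (fun s : R => poisson_hermite s f x) t.

(* the smallest integer greater than a, for 0 <= a (see besov_orderP) *)
Definition besov_order (a : R) : nat := (Num.truncn a).+1.

Lemma besov_orderP (a : R) (k : nat) : 0 <= a ->
  (a < k%:R) = (besov_order a <= k)%N.
Proof. by move=> a0; rewrite /besov_order truncn_lt_nat. Qed.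

Definition poisson_hermite_deriv_norm p (k : nat) f (t : R) : \bar R :=
  'N[gaussian R d]_p[EFin \o poisson_hermite_deriv k f t].

Definition besov_cond (a : R) p q f : Prop :=
  let k := besov_order a in
  match q with
  | q'%:E =>
    ((\int[@lebesgue_measure R]_(t in `]0%R, +oo[)
       (((t `^ (k%:R - a))%:E * poisson_hermite_deriv_norm p k f t) `^ q'
        * (t^-1)%:E)) `^ q'^-1 < +oo)%E
  | +oo%E => exists A : R, forall t : R, 0 < t ->
    (poisson_hermite_deriv_norm p k f t <= (A * t `^ (- k%:R + a))%:E)%E
  | -oo%E => False
  end.

Definition besov (a : R) p q : set (d.-tuple R -> R) :=
  [set f | f \in Lfun (gaussian R d) p /\ besov_cond a p q f].

End besov.

Arguments besov {R} d a p q.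

(* Main.v *)
Require Import Defs.
From HB Require Import structures.
From mathcomp Require Import all_boot all_order all_algebra.
From mathcomp Require Import all_classical all_reals all_analysis.
From mathcomp Require Import measurable_realfun ess_sup_inf ring lra.

Import Order.TTheory GRing.Theory Num.Theory.
Import numFieldNormedType.Exports.

Set Implicit Arguments.
Unset Strict Implicit.
Unset Printing Implicit Defensive.

Local Open Scope classical_set_scope.
Local Open Scope ring_scope.

(* Let N_k(t) be the L^p(gamma_d) norm of the k-th t-derivative of P_t f.  P_t is
   the subordination of the Mehler kernel, which is a symmetric Markov kernel for
   gamma_d, by the 1/2-stable density g_t.  Since P_r is a contraction of L^p and
   maps the k-th derivative of P_t f to that of P_{t+r} f, N_k is nonincreasing;
   since |d^k g_t / dt^k| <= C t^-k g_{t/2}, N_k(t) <= C t^-k; the mean value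
   theorem gives N_k(t) <= N_k(2t) + 3 t N_{k+1}(t/2).  These three facts suffice:
   monotonicity turns an integral condition into N_k(t) = O(t^(alpha-k)), which
   gives (ii); iterating the last inequality over dyadic scales lowers the order
   of the derivative when alpha1 is replaced by some b <= alpha1
   with alpha2 < b < k, which controls t <= 1 in (i), and N_k(t) <= C t^-k
   controls t >= 1 because alpha2 > 0. *)

(** The derivatives in t are taken at each fixed point x, so the identities for P_t f must hold for
    every x and not only almost everywhere. This is why the Mehler kernel gets a bound that is
    uniform in y for each x: it makes P_t |f|(x) finite for every f in L^1 and justifies each use of
    Fubini. The kernel is taken with respect to gamma_d and not Lebesgue measure; there it is
    symmetric with mass one, so contraction follows from Jensen's inequality and Tonelli. The
    semigroup law of P_t rests on g_r * g_t = g_(r+t), which is proved by an explicit antiderivative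
    in terms of the normal distribution function instead of a Laplace transform. That P_r commutes
    with the derivatives in t is obtained by writing P_r P_t f as one integral over z, s and y,
    whose only dependence on t is through g_t(s). *)

Section real_line.
Context {R : realType}.
Local Notation leb := (@lebesgue_measure R).

(** Improper integrals of nonnegative functions: monotone convergence along compact intervals, with
    the fundamental theorem on each of them. It serves the mass of the stable density, the
    convolution identity and the integrals of powers near 0 and near infinity. *)
Lemma ge0_FTC_exhaustion (f F : R -> R) (a b : R^nat) (I : set R) (l : R) :
  (forall n, a n < b n) ->
  nondecreasing_seq (fun n => `[a n, b n]%classic) ->
  I = \bigcup_n `[a n, b n]%classic ->
  (forall x, I x -> 0 <= f x) ->
  (forall x, I x -> {for x, continuous f}) ->
  (forall x, I x -> is_derive x (1 : R) F (f x)) ->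
  F (b n) - F (a n) @[n --> \oo] --> l ->
  (\int[leb]_(x in I) (f x)%:E = l%:E)%E.
Proof.
move=> ab ndI IE f0 cf dF cvl.
have subI n : `[a n, b n] `<=` I by rewrite IE => x xn; exists n.
have cwf n : {within `[a n, b n], continuous f}.
  apply: continuous_in_subspaceT => x; rewrite inE => xab.
  by apply: cf; exact: (subI n).
have mf n : measurable_fun `[a n, b n] (fun x => (f x)%:E).
  apply/measurable_EFinP.
  by apply: subspace_continuous_measurable_fun => //; exact: cwf.
rewrite IE.
have fp i x : `[a i, b i]%classic x -> (0 <= (f x)%:E)%E.
  by move=> xi; rewrite lee_fin; apply: f0; exact: (subI i).
have H := @ge0_nondecreasing_set_cvg_integral _ _ _ _ _ leb ndI
  (fun=> measurable_itv _) mf fp.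
have E n : (\int[leb]_(x in `[a n, b n]) (f x)%:E = (F (b n) - F (a n))%:E)%E.
  rewrite EFinB; apply: continuous_FTC2 => //.
    split.
    - move=> x xab; have := @dF x; case=> //.
      by apply: (subI n); exact: subset_itv_oo_cc xab.
    - apply: cvg_at_right_filter; apply: differentiable_continuous.
      apply/derivable1_diffP; have [] // := dF (a n) _.
      by apply: (subI n); rewrite /= in_itv/= lexx ltW.
    - apply: cvg_at_left_filter; apply: differentiable_continuous.
      apply/derivable1_diffP; have [] // := dF (b n) _.
      by apply: (subI n); rewrite /= in_itv/= lexx ltW.
  move=> x xab; rewrite derive1E; have [] // := dF x _.
  by apply: (subI n); exact: subset_itv_oo_cc xab.
move: H; under eq_cvg do rewrite E.
move=> H; apply: (cvg_unique _ H) => //.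
by apply: cvg_EFin => //; exact: nearW.
Qed.

Lemma lebesgue_measureD (u : R) (A : set R) : measurable A ->
  pushforward leb (+%R u : _ -> measurableTypeR R) A = leb A.
Proof.
move=> mA; apply/esym/lebesgue_measure_unique => //=.
  by apply: (@measurable_funD _ (measurableTypeR R) _ setT (cst u) id).
move=> _ _ [[a b]] _ <-.
rewrite /pushforward.
rewrite (_ : _ @^-1` _ = `]a - u, b - u]%classic); last first.
  by apply/seteqP; split => x /=; rewrite !in_itv/= ltrBlDl lerBrDl.
rewrite !lebesgue_measure_itv/= !lte_fin ltrD2r.
by case: ifPn => // _; rewrite -!EFinD opprB addrA subrK.
Qed.

(** * The standard normal distribution function *)

Definition Phi (x : R) : R :=
  \int[leb]_(t in `]-oo, x]) normal_pdf 0 1 t.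

Lemma is_derive_Phi (x : R) : is_derive x (1 : R) Phi (normal_pdf 0 1 x).
Proof.
have x1 : x < x + 1 by rewrite ltrDl.
have ix : leb.-integrable `]-oo, (x + 1)] (EFin \o normal_pdf 0 (1 : R)).
  by apply: (@integrableS _ _ _ _ setT) => //; exact: integrable_normal_pdf.
have cx : {for x, continuous (normal_pdf 0 (1 : R))}.
  by apply: continuous_normal_pdf; exact: oner_neq0.
have [d1 d2] := continuous_FTC1 x1 ix (ltNyr _) cx.
by split; [exact: d1|rewrite -derive1E].
Qed.

(** The identity as a random variable under the normal law, so that the limits of [cdf] at both
    infinities transfer to [Phi]. *)
Let idTR : measurableTypeR R -> R := idfun.
HB.instance Definition _ :=
  @isMeasurableFun.Build _ _ _ _ idTR (@measurable_id _ _ setT).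

Lemma PhiE x :
  cdf (idTR : {RV (normal_prob 0 1 : probability _ R) >-> R}) x = (Phi x)%:E.
Proof.
rewrite /cdf /Phi /distribution /pushforward /= /normal_prob preimage_id.
rewrite /Rintegral fineK//; apply: integrable_fin_num => //.
by apply: (@integrableS _ _ _ _ setT) => //; exact: integrable_normal_pdf.
Qed.

Lemma cvg_Phiy : Phi x @[x --> +oo] --> (1 : R).
Proof.
have := cvg_cdfy1 (idTR : {RV (normal_prob 0 1 : probability _ R) >-> R}).
under eq_cvg do rewrite PhiE.
by move=> /fine_cvg.
Qed.

Lemma cvg_PhiNy : Phi x @[x --> -oo] --> (0 : R).
Proof.
have := cvg_cdfNy0 (idTR : {RV (normal_prob 0 1 : probability _ R) >-> R}).
under eq_cvg do rewrite PhiE.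
by move=> /fine_cvg.
Qed.

Lemma Phi0 : Phi 0 = 2^-1.
Proof.
have := integral_normal_pdf 0 (1 : R).
rewrite ge0_symfun_integralT; last 3 first.
- by move=> x; exact: normal_pdf_ge0.
- by apply: continuous_normal_pdf; exact: oner_neq0.
- by move=> x; rewrite /normal_pdf oner_eq0 /normal_fun /= !subr0 sqrrN.
rewrite (_ : [set x | _] = `[0, +oo[%classic); last first.
  by apply/seteqP; split => x/=; rewrite in_itv/= andbT.
rewrite ge0_integration_by_substitution0; last 2 first.
- by apply/measurable_EFinP; exact: measurable_normal_pdf.
- by move=> x; rewrite lee_fin; exact: normal_pdf_ge0.
rewrite (_ : \int[leb]_(r in _) _ = (Phi 0)%:E)%E; last first.
  rewrite -PhiE /cdf /distribution /pushforward /= /normal_prob preimage_id.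
  apply: eq_integral => x _.
  by rewrite /normal_pdf oner_eq0 /normal_fun !subr0 sqrrN.
rewrite -EFinM => -[] /(congr1 (fun x => x / 2)).
by rewrite mul1r mulrAC divff// mul1r.
Qed.

End real_line.

(** * The stable density *)

Section stable_density_theory.
Context {R : realType}.
Local Notation leb := (@lebesgue_measure R).

(** This and the next rules are stated for explicit lambda terms, so that derivatives are assembled
    as proof terms and the resulting formula is then fixed by [is_derive_eq] and [field]. *)
Lemma is_derive_comp (f g : R -> R) (x df dg : R) :
  is_derive (g x) (1 : R) f df -> is_derive x (1 : R) g dg ->
  is_derive x (1 : R) (fun y => f (g y)) (df * dg).
Proof. by move=> ? ?; exact: is_derive1_comp. Qed.

Lemma is_derive_mul (f g : R -> R) (x df dg : R) :
  is_derive x (1 : R) f df -> is_derive x (1 : R) g dg ->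
  is_derive x (1 : R) (fun y => f y * g y) (df * g x + f x * dg).
Proof.
move=> Hf Hg.
have := @is_deriveM _ _ f g x 1 df dg Hf Hg.
by rewrite /GRing.scale /= addrC (mulrC (g x)).
Qed.

Lemma is_derive_add (f g : R -> R) (x df dg : R) :
  is_derive x (1 : R) f df -> is_derive x (1 : R) g dg ->
  is_derive x (1 : R) (fun y => f y + g y) (df + dg).
Proof. by move=> ? ?; exact: is_deriveD. Qed.

Lemma is_derive_scale (c : R) (f : R -> R) (x df : R) :
  is_derive x (1 : R) f df ->
  is_derive x (1 : R) (fun y => c * f y) (c * df).
Proof. by move=> Hf; exact: (@is_deriveZ _ _ _ f c x 1 df). Qed.

Lemma is_derive_inv (f : R -> R) (x df : R) : f x != 0 ->
  is_derive x (1 : R) f df ->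
  is_derive x (1 : R) (fun y => (f y)^-1) (- (df / f x ^+ 2)).
Proof.
move=> fx0 [df1 <-]; split; first exact: derivableV.
rewrite deriveV//.
by rewrite /GRing.scale /= mulNr mulrC.
Qed.

Lemma is_derive_sqrt (f : R -> R) (x df : R) : 0 < f x ->
  is_derive x (1 : R) f df ->
  is_derive x (1 : R) (fun y => Num.sqrt (f y)) (df / (2 * Num.sqrt (f x))).
Proof.
move=> fx0 Hf; rewrite mulrC; apply: is_derive_comp => //.
exact: is_derive1_sqrt.
Qed.

Lemma measurable_fun_inv d (T : measurableType d) (D : set T) (f : T -> R) :
  measurable_fun D f -> measurable_fun D (fun x => (f x)^-1).
Proof.
(* Squaring makes the base nonnegative, where the power -1 is the inverse; where [f x = 0] both
   sides are 0. *)
move=> mf; rewrite (_ : (fun _ => _) = (fun x => f x * (f x ^+ 2) `^ (-1))).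
  apply: measurable_funM => //.
  apply: (measurableT_comp (measurable_powR _)).
  exact: measurable_funX.
apply/funext => x; rewrite powR_inv1 ?sqr_ge0//.
have [->|fx0] := eqVneq (f x) 0; first by rewrite invr0 mul0r.
by rewrite expr2 invfM mulrA divff// mul1r.
Qed.

(* stable_density with s^(3/2) written as sqrt(s)^3: the division by 0 makes it
   vanish for s <= 0, so that all integrals may be taken over the whole line. *)
Definition sdens (t s : R) : R :=
  t / (2 * Num.sqrt pi) * (expR (- (t ^+ 2 / (4 * s))) / Num.sqrt s ^+ 3).

Lemma sdens_ge0 t s : 0 <= t -> 0 <= sdens t s.
Proof.
by move=> t0; rewrite /sdens mulr_ge0 ?divr_ge0 ?expR_ge0 ?exprn_ge0 ?sqrtr_ge0.
Qed.

Lemma sdens_eq0 t s : s <= 0 -> sdens t s = 0.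
Proof. by move=> s0; rewrite /sdens (ler0_sqrtr s0) expr0n/= invr0 !mulr0. Qed.

Lemma measurable_sdens t : measurable_fun setT (sdens t).
Proof.
apply: measurable_funM => //; apply: measurable_funM.
  apply: measurableT_comp => //; apply: measurableT_comp => //.
  by apply: measurable_funM => //; apply: measurable_fun_inv.
apply: measurable_fun_inv; apply: measurable_funX.
by apply: continuous_measurable_fun; exact: sqrt_continuous.
Qed.

Lemma stable_densityE t s : 0 < s -> stable_density t s = sdens t s.
Proof.
move=> s0; rewrite /stable_density /sdens; congr (_ * (_ / _)).
have -> : (3 / 2 : R) = 2^-1 * 3%:R by rewrite mulrC.
by rewrite powRrM powR12_sqrt ?ltW// powR_mulrn// sqrtr_ge0.
Qed.

Lemma continuous_sdens (t s : R) : 0 < s -> {for s, continuous (sdens t)}.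
Proof.
move=> s0; apply: differentiable_continuous; apply/derivable1_diffP.
have s4 : 4 * s != 0 by rewrite mulf_neq0// ?gt_eqF//.
have q0 : Num.sqrt s ^+ 3 != 0 by rewrite expf_neq0// gt_eqF// sqrtr_gt0.
have H1 := is_derive_inv (f := fun s => 4 * s) s4
  (is_derive_scale 4 (is_derive_id s 1)).
have H2 := is_derive_comp (is_derive_expR _)
  (is_derive_scale (- t ^+ 2) H1).
have H3 := is_derive_inv (f := fun s => Num.sqrt s ^+ 3) q0
  (is_deriveX 3 (is_derive1_sqrt s0)).
have H := is_derive_scale (t / (2 * Num.sqrt pi)) (is_derive_mul H2 H3).
rewrite (_ : sdens t = fun y => t / (2 * Num.sqrt pi) *
  (expR (- t ^+ 2 * (4 * y)^-1) * (Num.sqrt y ^+ 3)^-1)).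
  by case: H.
by apply/funext => y; rewrite /sdens mulNr.
Qed.

Lemma sqrt2pi : normal_peak 1 = (Num.sqrt 2 * Num.sqrt pi)^-1 :> R.
Proof.
by rewrite /normal_peak expr1n mul1r -mulr_natl sqrtrM.
Qed.

Let c2 : R := Num.sqrt 2.
Let c2_gt0 : 0 < c2. Proof. by rewrite sqrtr_gt0. Qed.
Let c2_sqr : c2 ^+ 2 = 2. Proof. by rewrite sqr_sqrtr. Qed.
Let cp : R := Num.sqrt pi.
Let cp_gt0 : 0 < cp. Proof. by rewrite sqrtr_gt0 pi_gt0. Qed.

(** Dividing by sqrt 2 turns the exponent x^2/2 of the normal law into the x^2/4 of the stable
    density. *)
Lemma normal_pdf_scaled (x : R) :
  normal_pdf 0 1 (x / c2) = expR (- (x ^+ 2 / 4)) / (c2 * cp).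
Proof.
rewrite /normal_pdf oner_eq0 sqrt2pi mulrC /normal_fun; congr (expR _ * _).
rewrite subr0 expr1n expr_div_n c2_sqr.
by lra.
Qed.

Lemma is_derive_Phi_scaled (f : R -> R) (x df : R) :
  is_derive x (1 : R) f df ->
  is_derive x (1 : R) (fun y => Phi (f y / c2))
    (expR (- (f x ^+ 2 / 4)) * df / (2 * cp)).
Proof.
move=> Hf.
have H : is_derive x (1 : R) (fun y => f y / c2) (df / c2).
  apply: is_derive_eq (is_derive_mul Hf (is_derive_cst _ _ _)) _.
  by rewrite mulr0 addr0.
apply: is_derive_eq (is_derive_comp (is_derive_Phi _) H) _.
rewrite normal_pdf_scaled -c2_sqr.
have := gt_eqF c2_gt0; have := gt_eqF cp_gt0.
by move=> c0 p0; field; rewrite c0 p0.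
Qed.

(** In the variable t / sqrt s the density is Gaussian. Up to an additive constant the
    antiderivative is erfc (t / (2 sqrt s)). *)
Lemma sdens_antiderivative (t s : R) : 0 < s ->
  is_derive s (1 : R) (fun s => - 2 * Phi (t / Num.sqrt s / c2)) (sdens t s).
Proof.
move=> s0; have q0 : 0 < Num.sqrt s by rewrite sqrtr_gt0.
have H : is_derive s (1 : R) (fun s => t / Num.sqrt s)
    (- t / (2 * Num.sqrt s ^+ 3)).
  apply: is_derive_eq (is_derive_scale t (is_derive_inv _
     (is_derive1_sqrt s0))) _; first by rewrite gt_eqF.
  by field; rewrite gt_eqF.
apply: is_derive_eq (is_derive_scale (-2) (is_derive_Phi_scaled H)) _.
rewrite /sdens -/cp expr_div_n sqr_sqrtr ?ltW//.
rewrite (_ : t ^+ 2 / s / 4 = t ^+ 2 / (4 * s)); last by field; rewrite gt_eqF.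
by field; rewrite !gt_eqF.
Qed.

Lemma cvg_addn2y : ((n.+2)%:R : R) @[n --> \oo] --> +oo.
Proof.
have := @cvgr_idn R; rewrite -(cvg_shiftn 2) /=.
by under eq_fun do rewrite addn2.
Qed.

Lemma cvg_addn2V0 : ((n.+2)%:R^-1 : R) @[n --> \oo] --> (0 : R).
Proof.
apply/(@cvgrVy _ _ _ _ (fun n => (n.+2)%:R^-1)).
  by apply: nearW => n; rewrite invr_gt0.
under eq_cvg do rewrite /= invrK.
exact: cvg_addn2y.
Qed.

Lemma cvg_addn2_affine (c e : R) : 0 < c ->
  c * n.+2%:R + e / n.+2%:R @[n --> \oo] --> +oo.
Proof.
move=> c0; apply/cvgryPge => A.
have := cvg_addn2y; move=> /cvgryPge /(_ ((A + `|e|) / c)).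
apply: filterS => n; rewrite ler_pdivrMr// mulrC => h.
rewrite -lerBlDr; apply: le_trans h; rewrite lerD2l.
rewrite (le_trans (ler_norm _))// normrN normrM ler_piMr//.
by rewrite ger0_norm// invf_le1// ler1n.
Qed.

Lemma integral_sdens (t : R) : 0 < t -> (\int[leb]_s (sdens t s)%:E = 1)%E.
Proof.
move=> t0.
rewrite (_ : (\int[leb]_s _)%E = (\int[leb]_(s in `]0%R, +oo[) (sdens t s)%:E)%E); last first.
  rewrite [RHS]integral_mkcond; apply: eq_integral => s _.
  rewrite patchE; case: ifPn => //; rewrite notin_setE/= in_itv/= andbT.
  by move=> /negP; rewrite -leNgt => /sdens_eq0 ->.
(* The endpoints are squares, so that the square roots in the antiderivative become integers and
   their inverses. *)
apply: (@ge0_FTC_exhaustion _ _ (fun s => - 2 * Phi (t / Num.sqrt s / c2))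
  (fun n => n.+2%:R^-1 ^+ 2) (fun n => n.+2%:R ^+ 2)).
- move=> n; rewrite (@lt_trans _ _ 1)//.
    by rewrite exprn_ilt1// invf_lt1// ltr1n.
  by rewrite exprn_egt1// ltr1n.
- move=> m n mn; apply/subsetPset => x /=; rewrite !in_itv/= => /andP[mx xm].
  apply/andP; split.
    apply: le_trans mx; rewrite ler_sqr ?nnegrE//.
    by rewrite lef_pV2 ?posrE// ler_nat !ltnS.
  apply: (le_trans xm); rewrite ler_sqr ?nnegrE//.
  by rewrite ler_nat !ltnS.
- apply/seteqP; split => x /=; rewrite in_itv/= andbT.
    move=> x0.
    pose N := Num.bound (x + x^-1); exists N => //=; rewrite in_itv/=.
    have xN : x + x^-1 < N.+2%:R.
      have := archi_boundP (addr_ge0 (ltW x0) (ltW (y := x^-1) _)).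
      rewrite invr_gt0 => /(_ x0) h; apply: (lt_trans h).
      by rewrite ltr_nat ltnS leqnSn.
    have xi0 : 0 < x^-1 by rewrite invr_gt0.
    have N1 : 1 <= N.+2%:R :> R by rewrite ler1n.
    have xN1 : x < N.+2%:R by apply: le_lt_trans xN; rewrite lerDl ltW.
    have xN2 : x^-1 < N.+2%:R by apply: le_lt_trans xN; rewrite lerDr ltW.
    rewrite exprVn.
    apply/andP; split.
      rewrite -[leRHS]invrK lef_pV2 ?posrE ?exprn_gt0//.
      apply: (le_trans (ltW xN2)); rewrite expr2 ler_peMl//.
    by apply: (le_trans (ltW xN1)); rewrite expr2 ler_peMl//.
  move=> [n _ /=]; rewrite in_itv/= => /andP[+ _]; apply: lt_le_trans.
  by rewrite exprn_gt0.
- by move=> s _; exact: sdens_ge0 (ltW t0).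
- by move=> s; rewrite /= in_itv/= andbT; exact: continuous_sdens.
- by move=> s; rewrite /= in_itv/= andbT; exact: sdens_antiderivative.
(* At the upper end t / sqrt s tends to 0, at the lower end to infinity: the increment tends to -2
   (1/2) + 2 = 1. *)
rewrite [X in _ --> X](_ : _ = -2 * Phi 0 - (- 2) * 1); last by rewrite Phi0; lra.
under eq_cvg do rewrite !sqrtr_sqr !ger0_norm// invrK.
apply: cvgB; apply: cvgM; [exact: cvg_cst| |exact: cvg_cst|].
  apply: (@cvg_comp _ _ _ (fun n => t / n.+2%:R / c2)); last first.
    apply: differentiable_continuous; apply/derivable1_diffP.
    by case: (is_derive_Phi (0 : R)).
  rewrite (_ : nbhs 0 = nbhs (t * 0 / c2)); last by rewrite mulr0 mul0r.
  apply: cvgM; last exact: cvg_cst.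
  by apply: cvgM; [exact: cvg_cst|exact: cvg_addn2V0].
apply: (@cvg_comp _ _ _ (fun n => t * n.+2%:R / c2)); last exact: cvg_Phiy.
have tc0 : 0 < t / c2 by rewrite divr_gt0.
have := cvg_addn2_affine 0 tc0.
by under eq_cvg do rewrite mul0r addr0 mulrAC.
Qed.

(** * Convolution of two stable densities *)

Let conv_P (v u : R) : R := Num.sqrt u / Num.sqrt (v - u).
Let conv_Q (v u : R) : R := Num.sqrt (v - u) / Num.sqrt u.

Let is_derive_conv_P (v u : R) : 0 < u -> u < v ->
  is_derive u (1 : R) (conv_P v) (v / (2 * Num.sqrt u * Num.sqrt (v - u) ^+ 3)).
Proof.
move=> u0 uv; have vu : 0 < v - u by rewrite subr_gt0.
have H1 := is_derive_sqrt (f := fun u => v - u) vu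
  (is_derive_add (is_derive_cst v u 1) (is_deriveNid u 1)).
have q0 : Num.sqrt (v - u) != 0 by rewrite gt_eqF ?sqrtr_gt0.
apply: is_derive_eq (is_derive_mul (is_derive1_sqrt u0)
  (is_derive_inv (f := fun u => Num.sqrt (v - u)) q0 H1)) _.
have : v = Num.sqrt u ^+ 2 + Num.sqrt (v - u) ^+ 2.
  by rewrite !sqr_sqrtr ?ltW// addrC subrK.
have : 0 < Num.sqrt u by rewrite sqrtr_gt0.
move: q0; move: (Num.sqrt u) (Num.sqrt (v - u)) => A B B0 A0 ->.
by field; rewrite B0 gt_eqF.
Qed.

Let is_derive_conv_Q (v u : R) : 0 < u -> u < v ->
  is_derive u (1 : R) (conv_Q v) (- v / (2 * Num.sqrt u ^+ 3 * Num.sqrt (v - u))).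
Proof.
move=> u0 uv; have vu : 0 < v - u by rewrite subr_gt0.
have H1 := is_derive_sqrt (f := fun u => v - u) vu
  (is_derive_add (is_derive_cst v u 1) (is_deriveNid u 1)).
have q0 : Num.sqrt u != 0 by rewrite gt_eqF ?sqrtr_gt0.
apply: is_derive_eq (is_derive_mul H1 (is_derive_inv (f := Num.sqrt) q0 (is_derive1_sqrt u0))) _.
have : v = Num.sqrt u ^+ 2 + Num.sqrt (v - u) ^+ 2.
  by rewrite !sqr_sqrtr ?ltW// addrC subrK.
have : 0 < Num.sqrt (v - u) by rewrite sqrtr_gt0.
move: q0; move: (Num.sqrt u) (Num.sqrt (v - u)) => A B A0 B0 ->.
by field; rewrite A0 gt_eqF.
Qed.

(* With z = (t sqrt(u/(v-u)) - r sqrt((v-u)/u)) / sqrt v one has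
   t^2/(v-u) + r^2/u = (t+r)^2/v + z^2, and similarly with the signs of r
   changed; this turns the convolution integrand into a combination of two
   Gaussian densities. *)
Let conv_z (r t v u : R) : R := (t * conv_P v u - r * conv_Q v u) / Num.sqrt v.

Let conv_expE (r t v u : R) : 0 < u -> u < v ->
  expR (- ((t + r) ^+ 2 / (4 * v))) * expR (- (conv_z r t v u ^+ 2 / 4)) =
  expR (- (r ^+ 2 / (4 * u))) * expR (- (t ^+ 2 / (4 * (v - u)))).
Proof.
move=> u0 uv; have vu : 0 < v - u by rewrite subr_gt0.
rewrite -!expRD; congr expR; rewrite /conv_z /conv_P /conv_Q.
have -> : 4 * v = 4 * Num.sqrt v ^+ 2 by rewrite sqr_sqrtr ?(ltW (lt_trans u0 uv)).
have -> : 4 * u = 4 * Num.sqrt u ^+ 2 by rewrite sqr_sqrtr ?ltW.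
have -> : 4 * (v - u) = 4 * Num.sqrt (v - u) ^+ 2 by rewrite sqr_sqrtr ?ltW.
have : Num.sqrt v ^+ 2 = Num.sqrt u ^+ 2 + Num.sqrt (v - u) ^+ 2.
  by rewrite !sqr_sqrtr ?ltW//; [rewrite addrC subrK|exact: lt_trans uv].
have : Num.sqrt u != 0 by rewrite gt_eqF ?sqrtr_gt0.
have : Num.sqrt (v - u) != 0 by rewrite gt_eqF ?sqrtr_gt0.
have : Num.sqrt v != 0 by rewrite gt_eqF ?sqrtr_gt0// (lt_trans u0).
move: (Num.sqrt u) (Num.sqrt (v - u)) (Num.sqrt v) => A B V V0 B0 A0 VE.
apply/eqP; rewrite -subr_eq0; apply/eqP.
(* The difference of the two exponents is a multiple of V^2 - A^2 - B^2, which vanishes by [VE]. *)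
rewrite (_ : _ - _ = (t ^+ 2 / (B ^+ 2) * (V ^+ 2 - A ^+ 2 - B ^+ 2) +
   r ^+ 2 / (A ^+ 2) * (V ^+ 2 - A ^+ 2 - B ^+ 2)) / (4 * V ^+ 2)).
  by rewrite VE; field; rewrite A0 B0 -VE expf_neq0.
by field; rewrite A0 B0 V0.
Qed.

Let is_derive_conv_z (r t v u : R) : 0 < u -> u < v ->
  is_derive u (1 : R) (conv_z r t v)
    (Num.sqrt v / 2 * (t / (Num.sqrt u * Num.sqrt (v - u) ^+ 3) +
                       r / (Num.sqrt u ^+ 3 * Num.sqrt (v - u)))).
Proof.
move=> u0 uv; have vu : 0 < v - u by rewrite subr_gt0.
have H := is_derive_scale (Num.sqrt v)^-1 (is_derive_add
  (is_derive_scale t (is_derive_conv_P u0 uv))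
  (is_derive_scale (- r) (is_derive_conv_Q u0 uv))).
rewrite (_ : conv_z r t v = fun y => (Num.sqrt v)^-1 *
   (t * conv_P v y + - r * conv_Q v y)); last first.
  by apply/funext => y; rewrite /conv_z mulrC mulNr.
apply: is_derive_eq H _.
have : v = Num.sqrt v ^+ 2 by rewrite sqr_sqrtr ?(ltW (lt_trans u0 uv)).
have : Num.sqrt u != 0 by rewrite gt_eqF ?sqrtr_gt0.
have : Num.sqrt (v - u) != 0 by rewrite gt_eqF ?sqrtr_gt0.
have : Num.sqrt v != 0 by rewrite gt_eqF ?sqrtr_gt0// (lt_trans u0).
move: (Num.sqrt u) (Num.sqrt (v - u)) (Num.sqrt v) => A B V V0 B0 A0 ->.
by field; rewrite A0 B0 V0.
Qed.

(** An antiderivative of the convolution integrand. Put A = sqrt u and B = sqrt (v - u). By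
    [conv_expE] both terms produce the same Gaussian factor, with weights (t+r)(t/(A B^3) + r/(A^3
    B)) and (r-t)(t/(A B^3) - r/(A^3 B)). Their sum loses the terms in t^2 and r^2 and equals 2 r t
    v / (A^3 B^3), which is the shape of the integrand. *)
Let conv_F (r t v u : R) : R :=
  sdens (t + r) v * Phi (conv_z r t v u / c2) +
  sdens (r - t) v * Phi (conv_z (- r) t v u / c2).

Let is_derive_conv_F (r t v u : R) : 0 < u -> u < v ->
  is_derive u (1 : R) (conv_F r t v) (sdens r u * sdens t (v - u)).
Proof.
move=> u0 uv; have vu : 0 < v - u by rewrite subr_gt0.
have H1 := is_derive_Phi_scaled (is_derive_conv_z r t u0 uv).
have H2 := is_derive_Phi_scaled (is_derive_conv_z (- r) t u0 uv).
have H := is_derive_add (is_derive_scale (sdens (t + r) v) H1)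
   (is_derive_scale (sdens (r - t) v) H2).
apply: is_derive_eq H _.
have E1 := conv_expE r t u0 uv.
have E2 := conv_expE (- r) t u0 uv.
rewrite sqrrN -E1 -(sqrrN (t - r)) opprB in E2.
rewrite /sdens -/cp.
set e1 := expR (- (conv_z r t v u ^+ 2 / 4)) in E1 E2 *.
set e2 := expR (- (conv_z (- r) t v u ^+ 2 / 4)) in E2 *.
set f1 := expR (- ((t + r) ^+ 2 / (4 * v))) in E1 E2 *.
set f2 := expR (- ((r - t) ^+ 2 / (4 * v))) in E2 *.
set g1 := expR (- (r ^+ 2 / (4 * u))) in E1 *.
set g2 := expR (- (t ^+ 2 / (4 * (v - u)))) in E1 *.
have : Num.sqrt v ^+ 2 = Num.sqrt u ^+ 2 + Num.sqrt (v - u) ^+ 2.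
  by rewrite !sqr_sqrtr ?ltW//; [rewrite addrC subrK|exact: lt_trans uv].
have : Num.sqrt u != 0 by rewrite gt_eqF ?sqrtr_gt0.
have : Num.sqrt (v - u) != 0 by rewrite gt_eqF ?sqrtr_gt0.
have : Num.sqrt v != 0 by rewrite gt_eqF ?sqrtr_gt0// (lt_trans u0).
move: (Num.sqrt u) (Num.sqrt (v - u)) (Num.sqrt v) => A B V V0 B0 A0 VE.
have p0 : cp != 0 by rewrite gt_eqF.
rewrite [LHS](_ : _ = (f1 * e1) * ((t + r) * (t / (A * B ^+ 3) + r / (A ^+ 3 * B))
   / (8 * cp ^+ 2 * V ^+ 2)) +
   (f2 * e2) * ((r - t) * (t / (A * B ^+ 3) - r / (A ^+ 3 * B))
   / (8 * cp ^+ 2 * V ^+ 2))); last by field; rewrite A0 B0 V0 p0.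
rewrite [RHS](_ : _ = (g1 * g2) * (r * t / (4 * cp ^+ 2 * A ^+ 3 * B ^+ 3))); last first.
  by field; rewrite A0 B0 p0.
rewrite E2 E1 VE; field.
by rewrite A0 B0 p0 -VE expf_neq0.
Qed.

Lemma sdens_conv (r t v : R) : 0 < r -> 0 < t ->
  (\int[leb]_u (sdens r u * sdens t (v - u))%:E = (sdens (r + t) v)%:E)%E.
Proof.
move=> r0 t0; have [v0|v0] := leP v 0.
  rewrite sdens_eq0//; apply: integral0_eq => u _.
  have [u0|u0] := leP u 0; first by rewrite sdens_eq0// mul0r.
  by rewrite [sdens t _]sdens_eq0 ?mulr0// subr_le0 (le_trans v0)// ltW.
rewrite (_ : (\int[leb]_u _)%E =
    (\int[leb]_(u in `]0%R, v[) (sdens r u * sdens t (v - u))%:E)%E); last first.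
  rewrite [RHS]integral_mkcond; apply: eq_integral => u _.
  rewrite patchE; case: ifPn => //; rewrite notin_setE/= in_itv/= => /negP.
  rewrite negb_and -!leNgt => /orP[u0|vu]; first by rewrite sdens_eq0// mul0r.
  by rewrite [sdens t _]sdens_eq0 ?mulr0// subr_le0.
(* Chosen so that (v - x_n) / x_n = (n+2)^2: at the endpoints x_n and v - x_n, [conv_P] and [conv_Q]
   take the values n+2 and 1/(n+2). *)
pose x_ n := v / (1 + n.+2%:R ^+ 2).
have x0 n : 0 < x_ n by rewrite divr_gt0// ltr_pwDl// sqr_ge0.
have d0 n : 1 + n.+2%:R ^+ 2 != 0 :> R by rewrite gt_eqF// ltr_pwDl// sqr_ge0.
have x1 n : x_ n * n.+2%:R ^+ 2 = v - x_ n by rewrite /x_; field.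
apply: (@ge0_FTC_exhaustion R (fun u => sdens r u * sdens t (v - u))
  (conv_F r t v) x_ (fun n => v - x_ n) `]0, v[%classic).
- by move=> n; rewrite -x1 ltr_pMr// exprn_egt1// ltr1n.
- apply/nondecreasing_seqP => n; apply/subsetPset => x /=; rewrite !in_itv/=.
  move=> /andP[nx xn].
  have h : x_ n.+1 <= x_ n.
    rewrite ler_pM2l// lef_pV2 ?posrE ?ltr_pwDl ?sqr_ge0// lerD2l.
    by rewrite ler_sqr ?nnegrE// ler_nat.
  by rewrite (le_trans h)//= (le_trans xn)// lerD2l lerN2.
- apply/seteqP; split => x /=; rewrite in_itv/=.
    move=> /andP[x00 xv]; have vx : 0 < v - x by rewrite subr_gt0.
    pose y := v / x + v / (v - x).
    have y1 : 0 < v / x by rewrite divr_gt0.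
    have y2 : 0 < v / (v - x) by rewrite divr_gt0.
    have y0 : 0 <= y by rewrite ltW// addr_gt0.
    exists (Num.bound y) => //=; rewrite in_itv/=.
    set N := Num.bound y.
    have yN : y <= 1 + N.+2%:R ^+ 2.
      have h := archi_boundP y0.
      rewrite (le_trans (ltW h))// ler_wpDl//.
      have NN : (N <= N.+2)%N by rewrite -addn2 leq_addr.
      rewrite (@le_trans _ _ N.+2%:R)//; first by rewrite ler_nat.
      by rewrite expr2 ler_peMl// ler1n.
    apply/andP; split.
      rewrite ler_pdivrMr ?ltr_pwDl ?sqr_ge0// mulrC -ler_pdivrMr//.
      by rewrite (le_trans _ yN)// lerDl ltW.
    rewrite lerBrDr -lerBrDl.
    rewrite ler_pdivrMr ?ltr_pwDl ?sqr_ge0// mulrC -ler_pdivrMr//.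
    by rewrite (le_trans _ yN)// lerDr ltW.
  move=> [n _ /=]; rewrite in_itv/= => /andP[h1 h2].
  by rewrite (lt_le_trans (x0 n))//= (le_lt_trans h2)// ltrBlDr ltrDl.
- by move=> u _; rewrite mulr_ge0// sdens_ge0// ltW.
- move=> u; rewrite /= in_itv/= => /andP[u0 uv].
  apply: cvgM; first exact: continuous_sdens.
  apply: (@continuous_comp _ _ _ (fun u => v - u) (sdens t)).
    by apply: cvgB; [exact: cvg_cst|exact: cvg_id].
  by apply: continuous_sdens; rewrite subr_gt0.
- by move=> u; rewrite /= in_itv/= => /andP[u0 uv]; exact: is_derive_conv_F.
have V0 : 0 < Num.sqrt v by rewrite sqrtr_gt0.
have Pa n : conv_P v (x_ n) = n.+2%:R^-1.
  rewrite /conv_P -x1 (sqrtrM _ (ltW (x0 n))) sqrtr_sqr ger0_norm// invfM mulrA divff ?mul1r//.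
  by rewrite gt_eqF// sqrtr_gt0.
have Qa n : conv_Q v (x_ n) = n.+2%:R.
  rewrite /conv_Q -x1 (sqrtrM _ (ltW (x0 n))) sqrtr_sqr ger0_norm// mulrAC divff ?mul1r//.
  by rewrite gt_eqF// sqrtr_gt0.
have Pb n : conv_P v (v - x_ n) = n.+2%:R by rewrite -[RHS]Qa /conv_P /conv_Q subKr.
have Qb n : conv_Q v (v - x_ n) = n.+2%:R^-1 by rewrite -[RHS]Pa /conv_P /conv_Q subKr.
have za a n : conv_z a t v (x_ n) / c2 =
    - ((a / (Num.sqrt v * c2)) * n.+2%:R + (- t / (Num.sqrt v * c2)) / n.+2%:R).
  by rewrite /conv_z Pa Qa; field; rewrite !gt_eqF ?ltr_wpDr ?ler0n ?ltr0n.
have zb a n : conv_z a t v (v - x_ n) / c2 =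
    (t / (Num.sqrt v * c2)) * n.+2%:R + (- a / (Num.sqrt v * c2)) / n.+2%:R.
  by rewrite /conv_z Pb Qb; field; rewrite !gt_eqF ?ltr_wpDr ?ler0n ?ltr0n.
have Vc0 : 0 < Num.sqrt v * c2 by rewrite mulr_gt0.
have cb a : Phi (conv_z a t v (v - x_ n) / c2) @[n --> \oo] --> (1 : R).
  under eq_cvg do rewrite zb.
  apply: (@cvg_comp _ _ _ _ Phi _ _ _ _ cvg_Phiy).
  by apply: cvg_addn2_affine; rewrite divr_gt0.
have ca : Phi (conv_z r t v (x_ n) / c2) @[n --> \oo] --> (0 : R).
  under eq_cvg do rewrite za.
  apply: (@cvg_comp _ _ _ _ Phi _ _ _ _ cvg_PhiNy).
  by apply/cvgNrNy; apply: cvg_addn2_affine; rewrite divr_gt0.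
have ca' : Phi (conv_z (- r) t v (x_ n) / c2) @[n --> \oo] --> (1 : R).
  under eq_cvg do rewrite za opprD -mulNr -(mulNr (- r)) opprK.
  apply: (@cvg_comp _ _ _ _ Phi _ _ _ _ cvg_Phiy).
  under eq_cvg do rewrite -mulNr.
  by apply: cvg_addn2_affine; rewrite divr_gt0.
(* At u near v both arguments of [Phi] tend to +oo; at u near 0 the one with r tends to -oo and the
   one with -r to +oo. Hence the two terms in [sdens (r - t) v] cancel, whatever the sign of r -
   t. *)
rewrite [X in _ --> X](_ : _ = (sdens (t + r) v * 1 + sdens (r - t) v * 1) -
  (sdens (t + r) v * 0 + sdens (r - t) v * 1)); last first.
  by rewrite [r + t]addrC; ring.
rewrite /conv_F.
have cM (a l : R) (w : R^nat) : w @ \oo --> l -> a * w n @[n --> \oo] --> a * l.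
  by move=> wl; apply: cvgM => //; exact: cvg_cst.
exact: (cvgB (cvgD (cM _ _ _ (cb r)) (cM _ _ _ (cb (- r))))
             (cvgD (cM _ _ _ ca) (cM _ _ _ ca'))).
Qed.

End stable_density_theory.

(** * Derivatives of the stable density in t *)

Section stable_density_derivatives.
Context {R : realType}.
Local Notation leb := (@lebesgue_measure R).

(** By induction on the polynomial: each multiplication by w costs half of the exponential rate,
    since (e/2) w <= exp ((e/2) w). *)
Lemma poly_expR_bound (p : {poly R}) (e : R) : 0 < e ->
  exists2 C : R, 0 <= C & forall w : R, 0 <= w -> `|p.[w]| <= C * expR (e * w).
Proof.
elim/poly_ind: p e => [|p c IH] e e0.
  by exists 0 => // w _; rewrite horner0 normr0 mul0r.
have e20 : 0 < e / 2 by rewrite divr_gt0.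
have [C C0 HC] := IH _ e20.
exists (C * (e / 2)^-1 + `|c|).
  by rewrite addr_ge0 ?mulr_ge0// invr_ge0 ltW.
move=> w w0; rewrite hornerMXaddC (le_trans (ler_normD _ _))// mulrDl lerD//.
  have key : expR (e / 2 * w) * w <= (e / 2)^-1 * expR (e * w).
    have -> : e * w = e / 2 * w + e / 2 * w by rewrite -mulrDl -splitr.
    rewrite expRD mulrCA ler_wpM2l ?expR_ge0//.
    rewrite -ler_pdivrMl ?invr_gt0// invrK.
    by apply: le_trans (expR_ge1Dx _); rewrite lerDr.
  rewrite normrM (ger0_norm w0) (le_trans (ler_wpM2r w0 (HC w w0)))//.
  by rewrite -(mulrA C) -(mulrA C) ler_wpM2l.
by rewrite ler_peMr// -expR0 ler_expR mulr_ge0// ltW.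
Qed.

(** Apart from factors free of t, the k-th derivative is t^(1-k) P(w) exp(-w) with w = t^2/(4s). As
    t dw/dt = 2w, one more derivative replaces P by (1-k) P + 2w P' - 2w P. *)
Fixpoint sdens_poly (k : nat) : {poly R} :=
  if k is k'.+1 then
    (1 - k'%:R) *: sdens_poly k' + 2 *: ('X * (sdens_poly k')^`())
    - 2 *: ('X * sdens_poly k')
  else 1.

(* The recursion for sdens_poly is the one that makes this the k-th derivative of
   sdens in t. *)
Definition sdens_d (k : nat) (t s : R) : R :=
  t^-1 ^+ k * (sdens_poly k).[t ^+ 2 / (4 * s)] * sdens t s.

Lemma sdens_d0 t s : sdens_d 0 t s = sdens t s.
Proof. by rewrite /sdens_d expr0 hornerC !mul1r. Qed.

Lemma is_derive_sdens_d (k : nat) (t s : R) : 0 < t ->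
  is_derive t (1 : R) (fun t => sdens_d k t s) (sdens_d k.+1 t s).
Proof.
move=> t0; have tn0 : t != 0 by rewrite gt_eqF.
have Hw : is_derive t (1 : R) (fun t => t ^+ 2 / (4 * s)) (2 * t / (4 * s)).
  have H := is_derive_scale (4 * s)^-1 (is_deriveX 2 (is_derive_id t 1)).
  rewrite (_ : (fun t => _) = fun y : R => (4 * s)^-1 * (id ^+ 2) y).
    by apply: is_derive_eq H _; rewrite /GRing.scale /= mulr1 expr1 mulrC.
  by apply/funext => y; rewrite mulrC.
have HP := is_derive_comp (is_derive_poly (sdens_poly k) _) Hw.
have HE := is_derive_comp (is_derive_expR _) (is_derive_scale (-1) Hw).
have HI : is_derive t (1 : R) (fun t => (t ^+ k)^-1) (- k%:R / (t * t ^+ k)).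
  have tk0 : t ^+ k != 0 by rewrite expf_neq0.
  have Hk : is_derive t (1 : R) (fun t => t ^+ k) (k%:R * t ^+ k.-1).
    have := is_deriveX k (is_derive_id t (1 : R)).
    by rewrite /GRing.scale /= mulr1 exprfctE.
  apply: is_derive_eq (is_derive_inv (f := fun t => t ^+ k) tk0 Hk) _.
  case: (k) tk0 => [|m] tk0; first by rewrite !mul0r oppr0 mul0r.
  have ym : t ^+ m != 0 by rewrite expf_neq0.
  rewrite -[1 *- m.+1]/(- (m.+1%:R)) (exprS t m) -pred_Sn.
  by move: (m.+1%:R : R) (t ^+ m) ym => c y ym; field; rewrite tn0 ym.
have HT := is_derive_scale (2 * Num.sqrt pi)^-1 (is_derive_id t 1).
have HEb := is_derive_scale (Num.sqrt s ^+ 3)^-1 HE.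
have := is_derive_mul (is_derive_mul HI HP) (is_derive_mul HT HEb).
rewrite (_ : (fun y => _) = (fun t => sdens_d k t s)); last first.
  apply/funext => y; rewrite /sdens_d /sdens exprVn mulN1r.
  by rewrite (mulrC y) (mulrC (expR _)).
move=> H; apply: is_derive_eq H _.
have HS w : (sdens_poly k.+1).[w] = (1 - k%:R) * (sdens_poly k).[w] +
    2 * (w * (sdens_poly k)^`().[w]) - 2 * (w * (sdens_poly k).[w]).
  by rewrite /= !hornerE /=; ring.
have tk0 : t ^+ k != 0 by rewrite expf_neq0.
have pi0 : Num.sqrt (pi : R) != 0 by rewrite gt_eqF// sqrtr_gt0 pi_gt0.
rewrite /sdens_d /sdens HS exprVn (exprS t k) !mulN1r.
have -> : 2 * t / (4 * s) = 2 * (t ^+ 2 / (4 * s)) / t.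
  (* The inverse of 4 s is generalized, so the computation holds for every s, including s = 0 with
     its default value. *)
  by move: (4 * s)^-1 => a; field.
move: (t ^+ 2 / (4 * s)) => w.
rewrite -[1 *- k]/(- (k%:R)).
move: (expR (- w)) (Num.sqrt s ^+ 3)^-1 (sdens_poly k).[w] (sdens_poly k)^`().[w] => e b P P'.
move: (k%:R : R) (t ^+ k) tk0 => c tk tk0.
by field; rewrite tn0 pi0 tk0.
Qed.

(** For fixed s the quotient of [sdens t s] by t is nonincreasing in t. *)
Lemma sdens_le (a t s : R) : 0 < a -> a <= t -> sdens t s <= t / a * sdens a s.
Proof.
move=> a0 at_; have t0 := lt_le_trans a0 at_.
have [s0|s0] := leP s 0; first by rewrite !sdens_eq0// mulr0.
rewrite /sdens !mulrA divfK ?gt_eqF// -!mulrA ler_wpM2l ?(ltW t0)//.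
rewrite ler_wpM2l// ?invr_ge0 ?mulr_ge0 ?sqrtr_ge0//.
rewrite ler_wpM2r// ?invr_ge0 ?exprn_ge0 ?sqrtr_ge0//.
rewrite ler_expR lerN2 !mulrA -!expr2 ler_wpM2r// ?invr_ge0 ?mulr_ge0 ?(ltW s0)//.
by rewrite ler_sqr ?nnegrE ?(ltW a0) ?(ltW t0).
Qed.

(** Halving t keeps a quarter of the exponent w = t^2/(4s); the remaining factor exp(-3w/4) is there
    to absorb polynomials in w. *)
Lemma sdens_half (t s : R) :
  sdens t s = 2 * expR (- (3 / 4 * (t ^+ 2 / (4 * s)))) * sdens (t / 2) s.
Proof.
rewrite /sdens.
have -> : t ^+ 2 / (4 * s) = 3 / 4 * (t ^+ 2 / (4 * s)) + (t / 2) ^+ 2 / (4 * s).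
  by move: (4 * s)^-1 => a; field.
rewrite opprD expRD.
set w := (t ^+ 2 / _).
have -> : 3 / 4 * (3 / 4 * w + (t / 2) ^+ 2 / (4 * s)) = 3 / 4 * w.
  by rewrite /w; move: (4 * s)^-1 => a; field.
have pi0 : Num.sqrt (pi : R) != 0 by rewrite gt_eqF// sqrtr_gt0 pi_gt0.
by move: (Num.sqrt s ^+ 3)^-1 => b; field.
Qed.

Lemma poly_sdens_le (p : {poly R}) : exists2 C : R, 0 <= C &
  forall t s : R, 0 <= t ->
    `|p.[t ^+ 2 / (4 * s)]| * sdens t s <= C * sdens (t / 2) s.
Proof.
have [C C0 HC] := poly_expR_bound p (divr_gt0 (ltr0n R 3) (ltr0n R 4)).
exists (2 * C) => [|t s t0]; first by rewrite mulr_ge0.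
have [s0|s0] := leP s 0; first by rewrite !sdens_eq0// !mulr0.
have w0 : 0 <= t ^+ 2 / (4 * s) by rewrite divr_ge0 ?sqr_ge0 ?mulr_ge0 ?ltW.
have g0 : 0 <= sdens (t / 2) s by rewrite sdens_ge0// divr_ge0.
rewrite sdens_half mulrA ler_wpM2r// mulrCA ler_wpM2l//.
by rewrite expRN ler_pdivrMr ?expR_gt0// HC.
Qed.

Lemma sdens_d_le (k : nat) : exists2 C : R, 0 <= C &
  forall t s : R, 0 < t ->
    `|sdens_d k t s| <= C * t^-1 ^+ k * sdens (t / 2) s.
Proof.
have [C C0 HC] := poly_sdens_le (sdens_poly k).
exists C => // t s t0.
have g0 : 0 <= sdens t s by rewrite sdens_ge0// ltW.
have tk : 0 <= t^-1 ^+ k by rewrite exprn_ge0// invr_ge0 ltW.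
rewrite /sdens_d 2!normrM (ger0_norm g0) (ger0_norm tk) (mulrC C).
by rewrite -(mulrA (t^-1 ^+ k)) -(mulrA (t^-1 ^+ k)) ler_wpM2l// HC// ltW.
Qed.

(* For s > 0 the factor 1 + 1/s is a polynomial in t^2/(4s). *)
Lemma sdens_inv_le (n : nat) (t : R) : 0 < t -> exists2 C : R, 0 <= C &
  forall s : R, (1 + s^-1) ^+ n * sdens t s <= C * sdens (t / 2) s.
Proof.
move=> t0; have [C C0 HC] := poly_sdens_le ((1 + (4 / t ^+ 2) *: 'X) ^+ n).
exists C => // s; apply: le_trans (HC t s (ltW t0)).
have [s0|s0] := leP s 0; first by rewrite !sdens_eq0// !mulr0.
rewrite ler_wpM2r ?sdens_ge0 ?(ltW t0)// horner_exp hornerD hornerZ hornerX hornerC.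
rewrite (_ : 4 / t ^+ 2 * (t ^+ 2 / (4 * s)) = s^-1) ?ler_norm//.
by field; rewrite !gt_eqF.
Qed.

Lemma measurable_sdens_d (k : nat) (t : R) : measurable_fun setT (sdens_d k t).
Proof.
apply: measurable_funM; last exact: measurable_sdens.
apply: measurable_funM => //.
apply: measurableT_comp.
  apply: continuous_measurable_fun => x; exact: continuous_horner.
apply: measurable_funM => //; apply: measurable_fun_inv.
exact: measurable_funM.
Qed.

End stable_density_derivatives.

(** * Differentiation under the integral sign *)

Section differentiation.
Context {R : realType} d (W : measurableType d).
Variables (nu : {measure set W -> \bar R}) (sigma H : W -> R).
Hypothesis msigma : measurable_fun setT sigma.
Hypothesis mH : measurable_fun setT H.
Hypothesis intH : forall a : R, 0 < a ->
  nu.-integrable setT (fun w => (sdens a (sigma w) * H w)%:E).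

Lemma integrable_sdens_d (k : nat) (t : R) : 0 < t ->
  nu.-integrable setT (fun w => (sdens_d k t (sigma w) * H w)%:E).
Proof.
move=> t0; have [C C0 HC] := @sdens_d_le R k.
have t20 : 0 < t / 2 by rewrite divr_gt0.
have := integrableZl measurableT (C * t^-1 ^+ k) (intH t20).
apply: le_integrable => //.
  apply/measurable_EFinP; apply: measurable_funM => //.
  apply: measurableT_comp => //; exact: measurable_sdens_d.
move=> w _; rewrite -EFinM !abse_EFin lee_fin (mulrA _ _ (H w)).
rewrite normrM [leRHS]normrM ler_wpM2r//.
exact: le_trans (HC _ _ t0) (ler_norm _).
Qed.

Lemma is_derive_integral_sdens_d (k : nat) (t : R) : 0 < t ->
  is_derive t (1 : R) (fun t => \int[nu]_w (sdens_d k t (sigma w) * H w))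
    (\int[nu]_w (sdens_d k.+1 t (sigma w) * H w)).
Proof.
move=> t0; have [C C0 HC] := @sdens_d_le R k.+1.
have t40 : 0 < t / 4 by rewrite divr_gt0.
pose f t w := sdens_d k t (sigma w) * H w.
(* A dominating function for x in ]t/2, 2t[: there 1/x <= 2/t, and x/2 lies between t/4 and t, so
   [sdens_le] bounds the density at x/2 by 4 times the one at t/4. *)
pose G w := C * (t / 2)^-1 ^+ k.+1 * 4 * `|sdens (t / 4) (sigma w) * H w|.
have tI : `]t / 2, 2 * t[%classic t.
  by rewrite /= in_itv/=; apply/andP; split; lra.
have Ipos x : `]t / 2, 2 * t[%classic x -> 0 < x.
  by rewrite /= in_itv/= => /andP[+ _]; apply: lt_trans; rewrite divr_gt0.
have df (x : R) w : 0 < x -> is_derive x (1 : R) (f ^~ w) (sdens_d k.+1 x (sigma w) * H w).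
  move=> x0; rewrite /f.
  have := is_derive_scale (H w) (is_derive_sdens_d k (sigma w) x0).
  by rewrite mulrC; under eq_fun do rewrite mulrC.
have intf x : `]t / 2, 2 * t[%classic x -> nu.-integrable setT (EFin \o f x).
  by move=> /Ipos x0; exact: integrable_sdens_d.
have derf x w : `]t / 2, 2 * t[%classic x -> setT w -> derivable (f ^~ w) x 1.
  by move=> /Ipos x0 _; have [] := df x w x0.
have G0 w : 0 <= G w.
  by rewrite /G !mulr_ge0// exprn_ge0// invr_ge0 ltW// divr_gt0.
have intG : nu.-integrable setT (EFin \o G).
  have := integrableZl measurableT (C * (t / 2)^-1 ^+ k.+1 * 4)
    (integrable_abse (intH t40)).
  by apply: eq_integrable => // w _.
have Gub x w : `]t / 2, 2 * t[%classic x -> setT w ->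
    `|partial1of2 f x w| <= G w.
  move=> xI _; have x0 := Ipos _ xI.
  rewrite partial1of2E; have [_ ->] := df x w x0.
  rewrite /G normrM (normrM (sdens _ _)) (mulrA _ _ `|H w|) ler_wpM2r//.
  have t2x : t / 2 <= x by move: xI; rewrite /= in_itv/= => /andP[/ltW].
  have g0 : 0 <= sdens (t / 4) (sigma w) by rewrite sdens_ge0// ltW.
  apply: (le_trans (HC _ _ x0)); rewrite (ger0_norm g0) -!mulrA ler_wpM2l//.
  apply: ler_pM => //.
  - by rewrite exprn_ge0// invr_ge0 ltW.
  - by rewrite sdens_ge0// divr_ge0// ltW.
  - rewrite ler_pXn2r ?nnegrE ?invr_ge0 ?(ltW x0) ?divr_ge0 ?(ltW t0)//.
    by rewrite lef_pV2 ?posrE ?divr_gt0.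
  apply: (le_trans (sdens_le _ t40 _)); first by lra.
  rewrite ler_wpM2r// ler_pdivrMr//.
  by move: xI; rewrite /= in_itv/= => /andP[_ h]; lra.
split.
  exact: (derivable_under_integral measurableT tI intf derf G0 intG Gub).
rewrite -derive1E (differentiation_under_integral measurableT tI intf derf G0 intG Gub).
apply: eq_Rintegral => w _; rewrite partial1of2E.
by have [_ ->] := df t w t0.
Qed.

Lemma derive1n_integral_sdens (k : nat) (t : R) : 0 < t ->
  derive1n k (fun t => \int[nu]_w (sdens t (sigma w) * H w)) t =
  \int[nu]_w (sdens_d k t (sigma w) * H w).
Proof.
elim: k t => [|k IH] t t0.
  by rewrite derive1n0; apply: eq_Rintegral => w _; rewrite sdens_d0.
rewrite derive1nS derive1E.
have [_ <-] := is_derive_integral_sdens_d k t0.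
apply: near_eq_derive => //.
by near=> x; apply: IH; near: x; exact: lt_nbhsr.
Unshelve. all: end_near. Qed.

End differentiation.

Section translation.
Context {R : realType}.
Local Notation leb := (@lebesgue_measure R).

Lemma ge0_integral_shift (u : R) (f : R -> \bar R) : measurable_fun setT f ->
  (forall x, (0 <= f x)%E) ->
  (\int[leb]_s f (u + s)%R = \int[leb]_s f s)%E.
Proof.
move=> mf f0.
have mu : measurable_fun setT (+%R u : measurableTypeR R -> measurableTypeR R).
  by apply: (@measurable_funD _ (measurableTypeR R) _ setT (cst u) id).
have := @ge0_integral_pushforward _ _ _ _ R _ mu leb setT f measurableT mf
  (fun x _ => f0 x).
rewrite preimage_setT => <-.
by apply: eq_measure_integral => A mA _; exact: lebesgue_measureD.
Qed.

End translation.

(** * Subordination of a symmetric Markov kernel *)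

(* The library declares two sigma-finite instances for product measures, and the
   one that is found requires subprobabilities; hence this alias. *)
Section lebesgue_product.
Context {R : realType} d (X : measurableType d).
Variable m : {sigma_finite_measure set X -> \bar R}.
Local Notation leb := (@lebesgue_measure R).

Definition leb_prod : set (measurableTypeR R * X) -> \bar R := (leb \x m)%E.

HB.instance Definition _ := Measure.on leb_prod.

Let leb_prod_sigma_finite : sigma_finite setT leb_prod.
Proof.
have /sigma_finiteP[F [TF ndF Foo]] := sigma_finiteT leb.
have /sigma_finiteP[G [TG ndG Goo]] := sigma_finiteT m.
exists (fun n => F n `*` G n).
  rewrite -setXTT TF TG predeqE => -[x y]; split.
    move=> [/= [n _ Fnx] [k _ Gky]]; exists (maxn n k) => //; split.
    - by move: x Fnx; exact/subsetPset/ndF/leq_maxl.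
    - by move: y Gky; exact/subsetPset/ndG/leq_maxr.
  by move=> [n _ []/= ? ?]; split; exists n.
move=> k; have [mF Fk] := Foo k; have [mG Gk] := Goo k.
split; first exact: measurableX.
by rewrite /leb_prod product_measure1E// lte_mul_pinfty// ge0_fin_numE.
Qed.

HB.instance Definition _ :=
  Measure_isSigmaFinite.Build _ _ _ leb_prod leb_prod_sigma_finite.

End lebesgue_product.

Section subordination.
Context {R : realType} d (X : measurableType d).
Variables (m : probability X R) (M : R -> X -> X -> R).
Local Notation leb := (@lebesgue_measure R).

(** The properties of the Mehler kernel with respect to gamma_d. Mass one and the composition law
    are demanded for positive times only; at other times the kernel is always multiplied by a
    vanishing [sdens]. *)
Hypothesis mM : measurable_fun setT (fun w : R * (X * X) => M w.1 w.2.1 w.2.2).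
Hypothesis M_ge0 : forall s x y, 0 <= M s x y.
Hypothesis M_sym : forall s x y, M s x y = M s y x.
Hypothesis M_mass : forall (s : R) x, 0 < s -> (\int[m]_y (M s x y)%:E = 1)%E.
Hypothesis M_comp : forall (u s : R) x y, 0 < u -> 0 < s ->
  (\int[m]_z (M u x z * M s z y)%:E = (M (u + s) x y)%:E)%E.

Lemma measurable_kernel_comp d' (T : measurableType d') (a : T -> R) (b c : T -> X) :
  measurable_fun setT a -> measurable_fun setT b -> measurable_fun setT c ->
  measurable_fun setT (fun w => M (a w) (b w) (c w)).
Proof.
move=> ma mb mc.
apply: (@measurableT_comp _ _ _ _ _ _ _ _ (fun w => (a w, (b w, c w))) mM).
by apply: measurable_fun_pair => //; exact: measurable_fun_pair.
Qed.

Definition pker (t : R) (x y : X) : \bar R :=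
  (\int[leb]_s (M s x y * sdens t s)%:E)%E.

Lemma pker_ge0 (t : R) x y : 0 <= t -> (0 <= pker t x y)%E.
Proof.
by move=> t0; apply: integral_ge0 => s _; rewrite lee_fin mulr_ge0// sdens_ge0.
Qed.

Lemma pkerC (t : R) x y : pker t x y = pker t y x.
Proof. by apply: eq_integral => s _; rewrite M_sym. Qed.

Lemma measurable_pker d' (T : measurableType d') (t : R) (b c : T -> X) :
  0 <= t -> measurable_fun setT b -> measurable_fun setT c ->
  measurable_fun setT (fun w => pker t (b w) (c w)).
Proof.
move=> t0 mb mc.
apply: (@measurable_fun_fubini_tonelli_F _ _ T (measurableTypeR R) R leb
  (fun z : T * measurableTypeR R => (M z.2 (b z.1) (c z.1) * sdens t z.2)%:E)).
- apply/measurable_EFinP/measurable_funM.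
    by apply: measurable_kernel_comp => //; exact: measurableT_comp.
  by apply: measurableT_comp => //; exact: measurable_sdens.
- by move=> z; rewrite lee_fin mulr_ge0// sdens_ge0.
Qed.

Lemma integral_pker (t : R) x : 0 < t -> (\int[m]_y pker t x y = 1)%E.
Proof.
move=> t0; have t0' := ltW t0.
have mf : measurable_fun setT (fun z : X * measurableTypeR R => (M z.2 x z.1 * sdens t z.2)%:E).
  apply/measurable_EFinP/measurable_funM; first exact: measurable_kernel_comp.
  by apply: measurableT_comp => //; exact: measurable_sdens.
rewrite (@fubini_tonelli _ _ X (measurableTypeR R) R m leb
  (fun z => (M z.2 x z.1 * sdens t z.2)%:E) mf); last first.
  by move=> z; rewrite lee_fin mulr_ge0// sdens_ge0.
rewrite -(integral_sdens t0); apply: eq_integral => s _ /=.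
have [s0|s0] := leP s 0.
  by rewrite sdens_eq0//; apply: integral0_eq => y _; rewrite mulr0.
under eq_integral do rewrite EFinM.
rewrite ge0_integralZr ?M_mass ?mul1e//.
- by apply/measurable_EFinP; exact: measurable_kernel_comp.
- by move=> y _; rewrite lee_fin.
- by rewrite lee_fin sdens_ge0.
Qed.

(** By Tonelli the z-integral is done first and [M_comp] gives M at time u + s. The substitution v =
    u + s isolates this factor, and the integral left in u is the convolution of [sdens_conv]. *)
Lemma pker_comp (r t : R) x y : 0 < r -> 0 < t ->
  (\int[m]_z (pker r x z * pker t z y) = pker (r + t) x y)%E.
Proof.
move=> r0 t0; have r0' := ltW r0; have t0' := ltW t0.
have mr := measurable_sdens r; have mt := measurable_sdens t.
transitivity (\int[m]_z \int[leb]_u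
    ((M u x z * sdens r u)%:E * pker t z y))%E.
  apply: eq_integral => z _; rewrite ge0_integralZr//.
  - apply/measurable_EFinP/measurable_funM => //; exact: measurable_kernel_comp.
  - by move=> u _; rewrite lee_fin mulr_ge0// sdens_ge0.
  - exact: pker_ge0.
rewrite (@fubini_tonelli _ _ X (measurableTypeR R) R m leb
  (fun w => ((M w.2 x w.1 * sdens r w.2)%:E * pker t w.1 y)%E)); first last.
- by move=> w; rewrite mule_ge0 ?pker_ge0// lee_fin mulr_ge0// sdens_ge0.
- apply: emeasurable_funM; last exact: measurable_pker.
  apply/measurable_EFinP/measurable_funM; first exact: measurable_kernel_comp.
  exact: measurableT_comp.
transitivity (\int[leb]_u \int[leb]_v
    (sdens r u * sdens t (v - u) * M v x y)%:E)%E.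
  apply: eq_integral => u _ /=.
  transitivity (\int[m]_z \int[leb]_s
      (M u x z * sdens r u * (M s z y * sdens t s))%:E)%E.
    apply: eq_integral => z _; rewrite -ge0_integralZl//.
    - apply/measurable_EFinP/measurable_funM => //; exact: measurable_kernel_comp.
    - by move=> s _; rewrite lee_fin mulr_ge0// sdens_ge0.
    - by rewrite lee_fin mulr_ge0// sdens_ge0.
  rewrite (@fubini_tonelli _ _ X (measurableTypeR R) R m leb
    (fun w => (M u x w.1 * sdens r u * (M w.2 w.1 y * sdens t w.2))%:E)); first last.
  - by move=> w; rewrite lee_fin !mulr_ge0// sdens_ge0.
  - apply/measurable_EFinP/measurable_funM.
      by apply: measurable_funM => //; exact: measurable_kernel_comp.
    apply: measurable_funM; first exact: measurable_kernel_comp.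
    exact: measurableT_comp.
  rewrite -[RHS](ge0_integral_shift u); first last.
  - by move=> v; rewrite lee_fin !mulr_ge0// sdens_ge0.
  - apply/measurable_EFinP/measurable_funM; last exact: measurable_kernel_comp.
    apply: measurable_funM => //; apply: measurableT_comp => //.
    exact: measurable_funB.
  apply: eq_integral => s _ /=.
  rewrite (addrC u) addrK.
  (* [M_comp] asks for positive times; when u or s is nonpositive one of the two densities is 0. *)
  have [u0|u0] := leP u 0.
    rewrite (sdens_eq0 r u0) !mul0r; apply: integral0_eq => z _.
    by rewrite mulr0 mul0r.
  have [s0|s0] := leP s 0.
    rewrite (sdens_eq0 t s0) mulr0 mul0r; apply: integral0_eq => z _.
    by rewrite !mulr0.
  rewrite (addrC s) [in RHS]EFinM -M_comp// -ge0_integralZl//; first last.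
  - by rewrite lee_fin mulr_ge0// sdens_ge0.
  - by move=> z _; rewrite lee_fin mulr_ge0.
  - by apply/measurable_EFinP/measurable_funM; exact: measurable_kernel_comp.
  by apply: eq_integral => z _; rewrite -EFinM; congr EFin; ring.
rewrite (@fubini_tonelli _ _ (measurableTypeR R) (measurableTypeR R) R leb leb
  (fun w => (sdens r w.1 * sdens t (w.2 - w.1) * M w.2 x y)%:E)); first last.
- by move=> w; rewrite lee_fin !mulr_ge0// sdens_ge0.
- apply/measurable_EFinP/measurable_funM; last exact: measurable_kernel_comp.
  apply: measurable_funM; first exact: measurableT_comp.
  by apply: measurableT_comp => //; exact: measurable_funB.
apply: eq_integral => v _ /=.
rewrite mulrC EFinM -sdens_conv// -ge0_integralZr//.
- apply/measurable_EFinP/measurable_funM => //.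
  by apply: measurableT_comp => //; exact: measurable_funB.
- by move=> u _; rewrite lee_fin mulr_ge0// sdens_ge0.
- by rewrite lee_fin.
Qed.

Lemma pker_le (a t : R) x y : 0 < a -> a <= t ->
  (pker t x y <= (t / a)%:E * pker a x y)%E.
Proof.
move=> a0 at_; have t0 := lt_le_trans a0 at_.
rewrite -ge0_integralZl//; first last.
- by rewrite lee_fin divr_ge0// ltW.
- by move=> s _; rewrite lee_fin mulr_ge0// sdens_ge0// ltW.
- apply/measurable_EFinP/measurable_funM; first exact: measurable_kernel_comp.
  exact: measurable_sdens.
apply: ge0_le_integral => //.
- by move=> s _; rewrite lee_fin mulr_ge0// sdens_ge0// ltW.
- apply/measurable_EFinP/measurable_funM; first exact: measurable_kernel_comp.
  exact: measurable_sdens.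
- apply: measurable_funeM; apply/measurable_EFinP/measurable_funM.
    exact: measurable_kernel_comp.
  exact: measurable_sdens.
- by move=> s _; rewrite -EFinM lee_fin (mulrCA (t / a)) ler_wpM2l// sdens_le.
Qed.

(** Polynomial growth in 1/s is harmless, being absorbed by the factor exp(-t^2/(4s)) of the stable
    density. Uniformity in y gives a bounded kernel for each x, hence finiteness at every x for f in
    L^1. *)
Hypothesis M_bound : exists n (B : X -> R), forall (s : R) x y, 0 < s ->
  M s x y <= B x * (1 + s^-1) ^+ n.

Lemma pker_bound (t : R) : 0 < t ->
  exists B : X -> R, forall x y, (pker t x y <= (B x)%:E)%E.
Proof.
move=> t0; have [n [B HB]] := M_bound; have [C C0 HC] := sdens_inv_le n t0.
have t20 : 0 < t / 2 by rewrite divr_gt0.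
(* [B] carries no sign assumption, hence the maximum with 0. *)
exists (fun x => Num.max (B x) 0 * C) => x y.
have B0 : 0 <= Num.max (B x) 0 by rewrite le_max lexx orbT.
rewrite -[leRHS]mule1 -(integral_sdens t20) -ge0_integralZl//; first last.
- by rewrite lee_fin mulr_ge0.
- by move=> s _; rewrite lee_fin sdens_ge0// ltW.
- by apply/measurable_EFinP; exact: measurable_sdens.
apply: ge0_le_integral => //.
- by move=> s _; rewrite lee_fin mulr_ge0// sdens_ge0// ltW.
- apply/measurable_EFinP/measurable_funM; first exact: measurable_kernel_comp.
  exact: measurable_sdens.
- by apply: measurable_funeM; apply/measurable_EFinP; exact: measurable_sdens.
- move=> s _; rewrite -EFinM lee_fin -mulrA.
  have [s0|s0] := leP s 0; first by rewrite !sdens_eq0// !mulr0.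
  apply: le_trans (ler_wpM2l B0 (HC s)); rewrite [leRHS]mulrA.
  rewrite ler_wpM2r ?sdens_ge0 ?(ltW t0)// (le_trans (HB _ _ _ s0))//.
  rewrite ler_wpM2r ?le_max ?lexx// exprn_ge0// addr_ge0// invr_ge0.
  exact: ltW.
Qed.

Lemma pker_fin_num (t : R) x y : 0 < t -> pker t x y \is a fin_num.
Proof.
move=> t0; have [B HB] := pker_bound t0.
by rewrite ge0_fin_numE ?pker_ge0 ?ltW// (le_lt_trans (HB x y))// ltry.
Qed.

(** * The operators P_t on nonnegative functions, and contraction *)

Definition pop (t : R) (h : X -> \bar R) (x : X) : \bar R :=
  (\int[m]_y (pker t x y * h y))%E.

Lemma pop_ge0 (t : R) h x : 0 <= t -> (forall y, 0 <= h y)%E -> (0 <= pop t h x)%E.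
Proof. by move=> t0 h0; apply: integral_ge0 => y _; rewrite mule_ge0 ?pker_ge0. Qed.

Lemma measurable_pop (t : R) h : 0 <= t -> (forall y, 0 <= h y)%E ->
  measurable_fun setT h -> measurable_fun setT (pop t h).
Proof.
move=> t0 h0 mh.
apply: (@measurable_fun_fubini_tonelli_F _ _ X X R m
  (fun z => pker t z.1 z.2 * h z.2)%E).
- apply: emeasurable_funM; first exact: measurable_pker.
  exact: measurableT_comp.
- by move=> z; rewrite mule_ge0 ?pker_ge0.
Qed.

Lemma le_pop (t : R) h1 h2 x : 0 <= t -> (forall y, 0 <= h1 y)%E ->
  measurable_fun setT h1 -> measurable_fun setT h2 ->
  (forall y, h1 y <= h2 y)%E -> (pop t h1 x <= pop t h2 x)%E.
Proof.
move=> t0 h10 m1 m2 h12; apply: ge0_le_integral => //.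
- by move=> y _; rewrite mule_ge0 ?pker_ge0.
- by apply: emeasurable_funM => //; exact: measurable_pker.
- by apply: emeasurable_funM => //; exact: measurable_pker.
- by move=> y _; rewrite lee_wpmul2l ?pker_ge0.
Qed.

Lemma le_pop_time (a t : R) h x : 0 < a -> a <= t -> (forall y, 0 <= h y)%E ->
  measurable_fun setT h -> (pop t h x <= (t / a)%:E * pop a h x)%E.
Proof.
move=> a0 at_ h0 mh; have t0 := lt_le_trans a0 at_.
have a0' := ltW a0; have t0' := ltW t0.
have ta0 : (0 <= (t / a)%:E)%E by rewrite lee_fin divr_ge0// ltW.
rewrite -ge0_integralZl//; first last.
- by move=> y _; rewrite mule_ge0 ?pker_ge0.
- by apply: emeasurable_funM => //; apply: measurable_pker => //; exact: ltW.
apply: ge0_le_integral => //.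
- by move=> y _; rewrite mule_ge0 ?pker_ge0.
- by apply: emeasurable_funM => //; apply: measurable_pker => //; exact: ltW.
- apply: measurable_funeM; apply: emeasurable_funM => //.
  by apply: measurable_pker => //; exact: ltW.
- by move=> y _; rewrite muleA lee_wpmul2r// pker_le.
Qed.

Lemma pop_comp (r t : R) h x : 0 < r -> 0 < t -> (forall y, 0 <= h y)%E ->
  measurable_fun setT h -> pop r (pop t h) x = pop (r + t) h x.
Proof.
move=> r0 t0 h0 mh; have r0' := ltW r0; have t0' := ltW t0.
transitivity (\int[m]_z \int[m]_y (pker r x z * (pker t z y * h y)))%E.
  apply: eq_integral => z _; rewrite ge0_integralZl ?pker_ge0//.
  - by apply: emeasurable_funM => //; exact: measurable_pker.
  - by move=> y _; rewrite mule_ge0 ?pker_ge0.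
rewrite (@fubini_tonelli _ _ X X R m m
  (fun w => pker r x w.1 * (pker t w.1 w.2 * h w.2))%E); first last.
- by move=> w; rewrite !mule_ge0 ?pker_ge0.
- apply: emeasurable_funM; first exact: measurable_pker.
  by apply: emeasurable_funM; [exact: measurable_pker|exact: measurableT_comp].
apply: eq_integral => y _ /=; rewrite -pker_comp//.
rewrite -ge0_integralZr//.
- by apply: eq_integral => z _; rewrite muleA.
- by apply: emeasurable_funM; exact: measurable_pker.
- by move=> z _; rewrite mule_ge0 ?pker_ge0.
Qed.

(** Invariance of m: by symmetry the kernel also has mass one in its first variable. *)
Lemma integral_pop (t : R) h : 0 < t -> (forall y, 0 <= h y)%E ->
  measurable_fun setT h -> (\int[m]_x pop t h x = \int[m]_x h x)%E.
Proof.
move=> t0 h0 mh; have t0' := ltW t0.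
rewrite (@fubini_tonelli _ _ X X R m m
  (fun w => (pker t w.1 w.2 * h w.2))%E); first last.
- by move=> w; rewrite !mule_ge0 ?pker_ge0.
- by apply: emeasurable_funM; [exact: measurable_pker|exact: measurableT_comp].
apply: eq_integral => y _ /=; rewrite ge0_integralZr//.
- by under eq_integral do rewrite pkerC; rewrite integral_pker// mul1e.
- exact: measurable_pker.
- by move=> z _; rewrite pker_ge0.
Qed.

Lemma measurable_fun_poweR (p : R) (u : X -> \bar R) :
  measurable_fun setT u -> measurable_fun setT (fun x => u x `^ p)%E.
Proof.
move=> mu.
apply: (@measurableT_comp _ _ _ _ _ _ (fun y : \bar R => y `^ p)%E) => //.
exact: measurable_poweR.
Qed.

Lemma le_Lnorm (p : \bar R) (u v : X -> \bar R) : (1 <= p)%E ->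
  measurable_fun setT u -> measurable_fun setT v ->
  (forall x, `|u x| <= `|v x|)%E -> ('N[m]_p[u] <= 'N[m]_p[v])%E.
Proof.
case: p => [p| |//].
- rewrite lee_fin => p1 mu mv uv; rewrite unlock.
  have p0 : 0 <= p := le_trans ler01 p1.
  have mp (w : X -> \bar R) : measurable_fun setT w ->
      measurable_fun setT (fun x => `|w x| `^ p)%E.
    by move=> mw; apply: measurable_fun_poweR; exact: measurableT_comp.
  apply: gt0_ler_poweR.
  + by rewrite invr_ge0.
  + by rewrite in_itv/= leey andbT integral_ge0// => x _; exact: poweR_ge0.
  + by rewrite in_itv/= leey andbT integral_ge0// => x _; exact: poweR_ge0.
  apply: ge0_le_integral => //.
  + by move=> x _; exact: poweR_ge0.
  + exact: mp.
  + exact: mp.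
  by move=> x _; apply: gt0_ler_poweR => //; rewrite in_itv/= leey andbT abse_ge0.
- move=> _ mu mv uv; rewrite unlock; case: ifPn => // _.
  by apply: le_ess_sup; apply: nearW => x /=; exact: uv.
Qed.

Lemma LnormZ_ge0 (p : \bar R) (c : R) (h : X -> R) : (1 <= p)%E -> 0 <= c ->
  measurable_fun setT h ->
  ('N[m]_p[EFin \o (fun x => c * h x)%R] = c%:E * 'N[m]_p[EFin \o h])%E.
Proof.
case: p => [p| |//].
- rewrite lee_fin => p1 c0 mh; rewrite unlock.
  have p0 : 0 < p := lt_le_trans ltr01 p1.
  under eq_integral => x _ do rewrite /= normrM powRM// EFinM.
  rewrite ge0_integralZl//; last first.
    apply/measurable_EFinP.
    apply: (@measurableT_comp _ _ _ _ _ _ (@powR R ^~ p)) => //.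
    exact: measurableT_comp.
  rewrite poweRM ?lee_fin ?powR_ge0//; last first.
    by apply: integral_ge0 => x _; rewrite lee_fin powR_ge0.
  rewrite poweR_EFin -powRrM divff ?gt_eqF// powRr1//.
  by rewrite ger0_norm.
- move=> _ c0 mh; rewrite unlock; case: ifPn => m0; last by rewrite mule0.
  rewrite -ess_supZl//; apply: eq_ess_sup; apply: nearW => x /=.
  by rewrite normrM EFinM (ger0_norm c0).
Qed.

(** Jensen's inequality for the probability density k = [pker t x], deduced from Hölder's inequality
    for the product of k^(1/p) h and k^(1/q), whose second factor has norm one. The case p = 1,
    where q would be infinite, is an equality. *)
Lemma pop_jensen (p t : R) (h : X -> R) (x : X) : 1 <= p -> 0 < t ->
  (forall y, 0 <= h y) -> measurable_fun setT h ->
  (pop t (EFin \o h) x `^ p <= pop t (fun y => (h y)%:E `^ p) x)%E.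
Proof.
rewrite le_eqVlt => /predU1P[<-|p1] t0 h0 mh.
  rewrite poweRe1; last by apply: pop_ge0 => [|y]; [exact: ltW|rewrite lee_fin].
  apply: le_pop => //; first exact: ltW.
  + by apply/measurable_EFinP.
  + by apply: measurable_fun_poweR; apply/measurable_EFinP.
  + by move=> y; rewrite poweRe1// lee_fin.
have p0 : 0 < p := lt_trans ltr01 p1.
have t0' := ltW t0.
pose q := (1 - p^-1)^-1.
have pV1 : p^-1 < 1 by rewrite invf_lt1.
have q0 : 0 < q by rewrite invr_gt0 subr_gt0.
have pq : p^-1 + q^-1 = 1 by rewrite invrK addrCA subrr addr0.
pose k y := fine (pker t x y).
have kE y : (k y)%:E = pker t x y by rewrite fineK// pker_fin_num.
have k0 y : 0 <= k y by rewrite fine_ge0// pker_ge0.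
have mk : measurable_fun setT k.
  by apply: measurableT_comp => //; exact: measurable_pker.
have mF : measurable_fun setT (fun y => k y `^ p^-1 * h y).
  by apply: measurable_funM => //; exact: (measurableT_comp (measurable_powR _)).
have mG : measurable_fun setT (fun y => k y `^ q^-1).
  exact: (measurableT_comp (measurable_powR _)).
have := @hoelder _ _ _ m _ _ p q mF mG p0 q0 pq.
rewrite Lnorm1.
have -> : (\int[m]_y `|(EFin \o ((fun y => k y `^ p^-1 * h y) \* (fun y => k y `^ q^-1))%R) y| =
  pop t (EFin \o h) x)%E.
  apply: eq_integral => y _; rewrite -kE /= -EFinM; congr EFin.
  rewrite ger0_norm ?mulr_ge0 ?powR_ge0// mulrAC -powRD ?pq ?powRr1//.
  by rewrite oner_eq0.
have -> : ('N[m]_q%:E[EFin \o (fun y => k y `^ q^-1)%R] = 1)%E.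
  rewrite unlock (_ : (\int[m]_y _)%E = 1%E) ?poweR1r//.
  rewrite -(integral_pker x t0); apply: eq_integral => y _.
  rewrite /= ger0_norm ?powR_ge0// -powRrM mulVf ?gt_eqF//.
  by rewrite powRr1// kE.
rewrite mule1 unlock.
have -> : (\int[m]_y `|(EFin \o (fun y => k y `^ p^-1 * h y)%R) y| `^ p =
   pop t (fun y => (h y)%:E `^ p) x)%E.
  apply: eq_integral => y _; rewrite -kE /= ger0_norm ?mulr_ge0 ?powR_ge0//.
  by rewrite powRM ?powR_ge0// -powRrM mulVf ?gt_eqF// powRr1// EFinM.
have J0 : (0 <= pop t (fun y => (h y)%:E `^ p) x)%E.
  by apply: pop_ge0 => // y; exact: poweR_ge0.
move=> H; rewrite -[leRHS]poweRe1// -(mulVf (negbT (gt_eqF p0))) poweRrM.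
apply: gt0_ler_poweR H; first exact: ltW.
- rewrite in_itv/= leey andbT; apply: pop_ge0 => // y; by rewrite lee_fin.
- by rewrite in_itv/= leey andbT poweR_ge0.
Qed.

(** For finite p: Jensen's inequality, then invariance of m. For infinite p: averages of h do not
    exceed its essential supremum. *)
Lemma pop_contraction (p : \bar R) (t : R) (h : X -> R) : (1 <= p)%E -> 0 < t ->
  (forall y, 0 <= h y) -> measurable_fun setT h ->
  ('N[m]_p[pop t (EFin \o h)] <= 'N[m]_p[EFin \o h])%E.
Proof.
move=> + t0 h0 mh; have t0' := ltW t0.
have mh' : measurable_fun setT (EFin \o h) by apply/measurable_EFinP.
have h0' y : (0 <= (EFin \o h) y)%E by rewrite lee_fin.
case: p => [p| |//].
- rewrite lee_fin => p1; rewrite unlock.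
  have p0 : 0 <= p := le_trans ler01 p1.
  apply: gt0_ler_poweR.
  + by rewrite invr_ge0.
  + by rewrite in_itv/= leey andbT integral_ge0// => x _; exact: poweR_ge0.
  + by rewrite in_itv/= leey andbT integral_ge0// => x _; exact: poweR_ge0.
  have mhp : measurable_fun setT (fun y => (h y)%:E `^ p)%E.
    exact: measurable_fun_poweR.
  have hp0 y : (0 <= (h y)%:E `^ p)%E by exact: poweR_ge0.
  rewrite [leRHS](_ : _ = \int[m]_x (h x)%:E `^ p)%E; last first.
    by apply: eq_integral => x _; rewrite gee0_abs.
  rewrite -(integral_pop t0 hp0 mhp).
  apply: ge0_le_integral => //.
  + by move=> x _; exact: poweR_ge0.
  + apply: measurable_fun_poweR.
    by apply: measurableT_comp => //; exact: measurable_pop.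
  + exact: measurable_pop.
  by move=> x _; rewrite gee0_abs ?pop_ge0//; exact: pop_jensen.
- move=> _; rewrite unlock; case: ifPn => // mpos.
  set c := ess_sup m (abse \o (EFin \o h)).
  have hc : \forall y \ae m, ((h y)%:E <= c)%E.
    apply: filterS (ess_sup_ge m (abse \o (EFin \o h))) => y /=.
    by rewrite ger0_norm.
  have c0 : (0 <= c)%E.
    by apply: ess_sup_gee => //; apply: nearW => y /=.
  (* The bound holds at every x: h exceeds c only on an m-null set, and the kernel has mass one with
     respect to m. *)
  apply/ess_supP; apply: nearW => x /=; rewrite gee0_abs ?pop_ge0//.
  rewrite -[leRHS]mul1e -(integral_pker x t0) -ge0_integralZr//; first last.
  + by move=> y _; exact: pker_ge0.
  + exact: measurable_pker.
  apply: ae_ge0_le_integral => //.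
  + by move=> y _; rewrite mule_ge0 ?pker_ge0.
  + by apply: emeasurable_funM => //; exact: measurable_pker.
  + by move=> y _; rewrite mule_ge0 ?pker_ge0.
  + by apply: emeasurable_funM => //; exact: measurable_pker.
  by apply: filterS hc => y hy _; rewrite lee_wpmul2l ?pker_ge0.
Qed.

(* With P_t f = int M_s f * sdens t s ds, this is the k-th derivative of P_t f in
   t, the derivative being taken under the integral sign. *)
Definition phd (f : X -> R) (k : nat) (t : R) (x : X) : R :=
  \int[leb_prod m]_w (sdens_d k t w.1 * (M w.1 x w.2 * f w.2)).

(** * Derivatives of P_t f and their commutation with P_r *)

Lemma pop_lty (f : X -> R) (t : R) x : 0 < t ->
  m.-integrable setT (EFin \o f) -> (pop t (fun y => `|f y|%:E) x < +oo)%E.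
Proof.
move=> t0 /integrableP[mf fy]; have t0' := ltW t0.
have [B HB] := pker_bound t0.
have B0 : (0 <= (B x)%:E)%E by apply: le_trans (pker_ge0 x x t0') (HB x x).
apply: (@le_lt_trans _ _ ((B x)%:E * \int[m]_y `|(EFin \o f) y|)%E); last first.
  by rewrite lte_mul_pinfty.
have mf' : measurable_fun setT (fun y => `|f y|%:E).
  by apply/measurable_EFinP; apply: measurableT_comp => //; apply/measurable_EFinP.
rewrite -ge0_integralZl//.
apply: ge0_le_integral => //.
- by move=> y _; rewrite mule_ge0 ?pker_ge0// lee_fin.
- by apply: emeasurable_funM => //; exact: measurable_pker.
- exact: measurable_funeM.
- by move=> y _; rewrite lee_wpmul2r// lee_fin.
Qed.

Lemma integral_phd_ge0 (g : X -> R) (t : R) x : 0 < t -> (forall y, 0 <= g y) ->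
  measurable_fun setT g ->
  (\int[leb_prod m]_w (sdens t w.1 * (M w.1 x w.2 * g w.2))%:E =
   pop t (EFin \o g) x)%E.
Proof.
move=> t0 g0 mg; have t0' := ltW t0; have mt := measurable_sdens t.
rewrite /leb_prod (@fubini_tonelli2 _ _ (measurableTypeR R) X R leb m
  (fun w => (sdens t w.1 * (M w.1 x w.2 * g w.2))%:E)); first last.
- by move=> w; rewrite lee_fin !mulr_ge0// sdens_ge0.
- apply/measurable_EFinP/measurable_funM; first exact: measurableT_comp.
  by apply: measurable_funM; [exact: measurable_kernel_comp|exact: measurableT_comp].
apply: eq_integral => y _; rewrite /fubini_G /= -ge0_integralZr//.
- by apply: eq_integral => s _; rewrite -EFinM; congr EFin; ring.
- by apply/measurable_EFinP/measurable_funM => //; exact: measurable_kernel_comp.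
- by move=> s _; rewrite lee_fin mulr_ge0// sdens_ge0.
- by rewrite lee_fin.
Qed.

(** P_r P_t g as one integral over (z, (s, y)), in which t occurs only in the stable density. The
    section on differentiation under the integral sign then applies to it with s as the time
    coordinate. *)
Lemma integral_phd3_ge0 (g : X -> R) (r t : R) x : 0 < r -> 0 < t ->
  (forall y, 0 <= g y) -> measurable_fun setT g ->
  (\int[(m \x leb_prod m)%E]_w (sdens t w.2.1 *
      (fine (pker r x w.1) * (M w.2.1 w.1 w.2.2 * g w.2.2)))%:E =
   pop (r + t) (EFin \o g) x)%E.
Proof.
move=> r0 t0 g0 mg; have t0' := ltW t0; have r0' := ltW r0.
have mt := measurable_sdens t.
have mk : measurable_fun setT (fun z => fine (pker r x z)).
  by apply: measurableT_comp => //; exact: measurable_pker.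
have k0 z : 0 <= fine (pker r x z) by rewrite fine_ge0// pker_ge0.
have mg' : measurable_fun setT (EFin \o g) by apply/measurable_EFinP.
rewrite (@fubini_tonelli1 _ _ X (measurableTypeR R * X)%type R m (leb_prod m)
  (fun w => (sdens t w.2.1 *
      (fine (pker r x w.1) * (M w.2.1 w.1 w.2.2 * g w.2.2)))%:E)); first last.
- by move=> w; rewrite lee_fin !mulr_ge0// sdens_ge0.
- apply/measurable_EFinP/measurable_funM.
    by apply: measurableT_comp => //; exact: measurableT_comp.
  apply: measurable_funM.
    by apply: measurableT_comp => //; apply: measurable_pker => //; exact: ltW.
  apply: measurable_funM; last by apply: measurableT_comp => //; exact: measurableT_comp.
  by apply: measurable_kernel_comp => //; exact: measurableT_comp.
rewrite -pop_comp//; apply: eq_integral => z _; rewrite /fubini_F /=.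
rewrite -(integral_phd_ge0 z t0 g0 mg) -ge0_integralZl ?pker_ge0//; first last.
- by move=> w _; rewrite lee_fin !mulr_ge0// sdens_ge0.
- apply/measurable_EFinP/measurable_funM; first exact: measurableT_comp.
  by apply: measurable_funM; [exact: measurable_kernel_comp|exact: measurableT_comp].
apply: eq_integral => w _.
by rewrite -(fineK (pker_fin_num x z r0)) -EFinM; congr EFin; ring.
Qed.

Lemma integrable_phd (f : X -> R) (t : R) x : 0 < t ->
  m.-integrable setT (EFin \o f) ->
  (leb_prod m).-integrable setT
    (fun w => (sdens t w.1 * (M w.1 x w.2 * f w.2))%:E).
Proof.
move=> t0 intf; have [/measurable_EFinP mf _] := integrableP _ _ _ intf.
have mt := measurable_sdens t.
apply/integrableP; split.
  apply/measurable_EFinP/measurable_funM; first exact: measurableT_comp.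
  by apply: measurable_funM; [exact: measurable_kernel_comp|exact: measurableT_comp].
apply: le_lt_trans (pop_lty x t0 intf).
rewrite -(integral_phd_ge0 (g := fun y => `|f y|))//; last first.
  exact: measurableT_comp.
rewrite le_eqVlt; apply/orP; left; apply/eqP; apply: eq_integral => w _.
rewrite abse_EFin normrM (normrM (M _ _ _)) (ger0_norm (M_ge0 _ _ _)).
by rewrite (ger0_norm (sdens_ge0 _ (ltW t0))).
Qed.

Lemma integrable_phd3 (f : X -> R) (r t : R) x : 0 < r -> 0 < t ->
  m.-integrable setT (EFin \o f) ->
  (m \x leb_prod m)%E.-integrable setT
    (fun w => (sdens t w.2.1 *
      (fine (pker r x w.1) * (M w.2.1 w.1 w.2.2 * f w.2.2)))%:E).
Proof.
move=> r0 t0 intf; have [/measurable_EFinP mf _] := integrableP _ _ _ intf.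
have mt := measurable_sdens t.
have mk : measurable_fun setT (fun z => fine (pker r x z)).
  by apply: measurableT_comp => //; apply: measurable_pker => //; exact: ltW.
have k0 z : 0 <= fine (pker r x z) by rewrite fine_ge0// pker_ge0// ltW.
apply/integrableP; split.
  apply/measurable_EFinP/measurable_funM.
    by apply: measurableT_comp => //; exact: measurableT_comp.
  apply: measurable_funM.
    by apply: measurableT_comp => //; apply: measurable_pker => //; exact: ltW.
  apply: measurable_funM; last by apply: measurableT_comp => //; exact: measurableT_comp.
  by apply: measurable_kernel_comp => //; exact: measurableT_comp.
apply: le_lt_trans (pop_lty x (addr_gt0 r0 t0) intf).
rewrite -(integral_phd3_ge0 (g := fun y => `|f y|) _ r0 t0)//; last first.
  exact: measurableT_comp.
rewrite le_eqVlt; apply/orP; left; apply/eqP; apply: eq_integral => w _.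
rewrite abse_EFin normrM (normrM (fine _)) (normrM (M _ _ _)).
by rewrite (ger0_norm (M_ge0 _ _ _)) (ger0_norm (k0 _)) (ger0_norm (sdens_ge0 _ (ltW t0))).
Qed.

(** The semigroup law for signed f, by splitting f into positive and negative parts, where Tonelli
    gives the value of both sides. *)
Lemma phd0_comp (f : X -> R) (r t : R) x : 0 < r -> 0 < t ->
  m.-integrable setT (EFin \o f) ->
  phd f 0 (r + t) x = \int[(m \x leb_prod m)%E]_w (sdens_d 0 t w.2.1 *
      (fine (pker r x w.1) * (M w.2.1 w.1 w.2.2 * f w.2.2))).
Proof.
move=> r0 t0 intf; have [/measurable_EFinP mf _] := integrableP _ _ _ intf.
have rt0 := addr_gt0 r0 t0.
have mp : measurable_fun setT f^\+ by exact: measurable_funrpos.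
have mn : measurable_fun setT f^\- by exact: measurable_funrneg.
have ip : m.-integrable setT (EFin \o f^\+).
  apply: le_integrable intf => //; first exact/measurable_EFinP.
  move=> y _; rewrite /= lee_fin ger0_norm ?funrpos_ge0//.
  by rewrite /funrpos ge_max ler_norm normr_ge0.
have in_ : m.-integrable setT (EFin \o f^\-).
  apply: le_integrable intf => //; first exact/measurable_EFinP.
  move=> y _; rewrite /= lee_fin ger0_norm ?funrneg_ge0//.
  by rewrite /funrneg ge_max normr_ge0 -normrN ler_norm.
have fE y : f y = f^\+ y - f^\- y by rewrite -[in LHS](funrposBneg f).
rewrite /phd.
under eq_Rintegral => w _ do rewrite sdens_d0 fE !mulrBr.
rewrite RintegralB//; [|exact: integrable_phd|exact: integrable_phd].
under [RHS]eq_Rintegral => w _ do rewrite sdens_d0 fE !mulrBr.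
rewrite RintegralB//; [|exact: integrable_phd3|exact: integrable_phd3].
rewrite /Rintegral !integral_phd_ge0 ?integral_phd3_ge0//.
Qed.

Lemma measurable_phd_weight (f : X -> R) x : measurable_fun setT f ->
  measurable_fun setT (fun w : measurableTypeR R * X => M w.1 x w.2 * f w.2).
Proof.
move=> mf; apply: measurable_funM; first exact: measurable_kernel_comp.
exact: measurableT_comp.
Qed.

Lemma is_derive_phd (f : X -> R) k (t : R) x : 0 < t ->
  m.-integrable setT (EFin \o f) ->
  is_derive t (1 : R) (fun t => phd f k t x) (phd f k.+1 t x).
Proof.
move=> t0 intf; have [/measurable_EFinP mf _] := integrableP _ _ _ intf.
apply: (@is_derive_integral_sdens_d R _ _ (leb_prod m) fst
  (fun w => M w.1 x w.2 * f w.2)) => //.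
- exact: measurable_phd_weight.
- by move=> a a0; exact: integrable_phd.
Qed.

(** P_r commutes with the derivatives in t: by induction on k the two sides agree for all positive
    t, so their t-derivatives agree too, and both are computed under the integral sign. *)
Lemma phd_comp (f : X -> R) (r : R) x k (t : R) : 0 < r -> 0 < t ->
  m.-integrable setT (EFin \o f) ->
  phd f k (r + t) x = \int[(m \x leb_prod m)%E]_w (sdens_d k t w.2.1 *
      (fine (pker r x w.1) * (M w.2.1 w.1 w.2.2 * f w.2.2))).
Proof.
move=> r0 + intf; have [/measurable_EFinP mf _] := integrableP _ _ _ intf.
elim: k t => [|k IH] t t0; first exact: phd0_comp.
have D1 := is_derive_comp (f := fun t => phd f k t x) (g := +%R r)
  (is_derive_phd k x (addr_gt0 r0 t0) intf)
  (is_derive_add (is_derive_cst r t 1) (is_derive_id t 1)).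
have D2 : is_derive t (1 : R)
    (fun t => \int[(m \x leb_prod m)%E]_w (sdens_d k t w.2.1 *
      (fine (pker r x w.1) * (M w.2.1 w.1 w.2.2 * f w.2.2))))
    (\int[(m \x leb_prod m)%E]_w (sdens_d k.+1 t w.2.1 *
      (fine (pker r x w.1) * (M w.2.1 w.1 w.2.2 * f w.2.2)))).
  apply: (@is_derive_integral_sdens_d R _ _ (m \x leb_prod m)%E
    (fun w => w.2.1) (fun w => fine (pker r x w.1) *
       (M w.2.1 w.1 w.2.2 * f w.2.2))) => //.
  - exact: measurableT_comp.
  - apply: measurable_funM.
      by apply: measurableT_comp => //; apply: measurable_pker => //; exact: ltW.
    apply: measurable_funM; last by apply: measurableT_comp => //; exact: measurableT_comp.
    by apply: measurable_kernel_comp => //; exact: measurableT_comp.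
  - by move=> a a0; exact: integrable_phd3.
have [_ <-] := D2.
move: D1; rewrite add0r mulr1 => -[_ <-].
apply: near_eq_derive => //.
by near=> u; apply: IH; near: u; exact: lt_nbhsr.
Unshelve. all: end_near. Qed.

Lemma measurable_phd (f : X -> R) k (t : R) : measurable_fun setT f ->
  measurable_fun setT (phd f k t).
Proof.
move=> mf; apply: measurableT_comp => //.
pose F (z : X * (measurableTypeR R * X)) :=
  (sdens_d k t z.2.1 * (M z.2.1 z.1 z.2.2 * f z.2.2))%:E.
have mF : measurable_fun setT F.
  apply/measurable_EFinP/measurable_funM.
    apply: measurableT_comp; first exact: measurable_sdens_d.
    exact: measurableT_comp.
  apply: measurable_funM; last by apply: measurableT_comp => //; exact: measurableT_comp.
  by apply: measurable_kernel_comp => //; exact: measurableT_comp.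
rewrite (_ : (fun x => _) = (fun x => \int[leb_prod m]_w F^\+ (x, w) -
    \int[leb_prod m]_w F^\- (x, w))%E); last first.
  apply/funext => x; rewrite [LHS]integralE; congr (_ - _)%E.
    by apply: eq_integral => w _; rewrite !funeposE.
  by apply: eq_integral => w _; rewrite !funenegE.
apply: emeasurable_funB.
- apply: (@measurable_fun_fubini_tonelli_F _ _ X _ R (leb_prod m) F^\+%E) => //.
  exact: measurable_funepos.
- apply: (@measurable_fun_fubini_tonelli_F _ _ X _ R (leb_prod m) F^\-%E) => //.
  exact: measurable_funeneg.
Qed.

Lemma integrable_phd_d (f : X -> R) k (t : R) x : 0 < t ->
  m.-integrable setT (EFin \o f) ->
  (leb_prod m).-integrable setT
    (fun w => (sdens_d k t w.1 * (M w.1 x w.2 * f w.2))%:E).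
Proof.
move=> t0 intf; have [/measurable_EFinP mf _] := integrableP _ _ _ intf.
apply: (@integrable_sdens_d R _ _ (leb_prod m) fst
  (fun w => M w.1 x w.2 * f w.2)) => //.
- exact: measurable_phd_weight.
- by move=> a a0; exact: integrable_phd.
Qed.

(** Fubini applied to [phd_comp]: integrating over (s, y) first leaves P_r of the k-th derivative at
    time t, and the absolute value passes inside P_r. *)
Lemma phd_semigroup_le (f : X -> R) k (r t : R) x : 0 < r -> 0 < t ->
  m.-integrable setT (EFin \o f) ->
  (`|phd f k (r + t) x|%:E <= pop r (fun z => `|phd f k t z|%:E) x)%E.
Proof.
move=> r0 t0 intf; have [/measurable_EFinP mf _] := integrableP _ _ _ intf.
rewrite phd_comp//.
pose F (w : X * (measurableTypeR R * X)) := (sdens_d k t w.2.1 *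
      (fine (pker r x w.1) * (M w.2.1 w.1 w.2.2 * f w.2.2)))%:E.
have intF : (m \x leb_prod m)%E.-integrable setT F.
  apply: (@integrable_sdens_d R _ _ (m \x leb_prod m)%E
    (fun w => w.2.1) (fun w => fine (pker r x w.1) *
       (M w.2.1 w.1 w.2.2 * f w.2.2))) => //.
  - exact: measurableT_comp.
  - apply: measurable_funM.
      by apply: measurableT_comp => //; apply: measurable_pker => //; exact: ltW.
    apply: measurable_funM; last by apply: measurableT_comp => //; exact: measurableT_comp.
    by apply: measurable_kernel_comp => //; exact: measurableT_comp.
  - by move=> a a0; exact: integrable_phd3.
rewrite EFin_normr_Rintegral// -(integral12_prod_meas1 intF).
have FE z : fubini_F (leb_prod m) F z = (pker r x z * (phd f k t z)%:E)%E.
  rewrite /fubini_F /phd /Rintegral fineK; last first.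
    exact: integrable_fin_num (integrable_phd_d k z t0 intf).
  rewrite -(fineK (pker_fin_num x z r0)) -integralZl//; last exact: integrable_phd_d.
  by apply: eq_integral => w _; rewrite /F -EFinM; congr EFin; ring.
apply: (le_trans (le_abse_integral m measurableT _)).
  exact: (measurable_fubini_F intF).
rewrite le_eqVlt; apply/orP; left; apply/eqP; apply: eq_integral => z _.
by rewrite FE abseM gee0_abs// pker_ge0// ltW.
Qed.

Lemma phd_le (f : X -> R) k : m.-integrable setT (EFin \o f) ->
  exists2 C : R, 0 <= C & forall (t : R) x, 0 < t ->
    (`|phd f k t x|%:E <=
      (C * t^-1 ^+ k)%:E * pop (t / 2) (fun y => `|f y|%:E) x)%E.
Proof.
move=> intf; have [/measurable_EFinP mf _] := integrableP _ _ _ intf.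
have [C C0 HC] := @sdens_d_le R k; exists C => // t x t0.
have t20 : 0 < t / 2 by rewrite divr_gt0.
have Ct0 : 0 <= C * t^-1 ^+ k by rewrite mulr_ge0// exprn_ge0// invr_ge0 ltW.
have mf' : measurable_fun setT (fun y => `|f y|) by exact: measurableT_comp.
have mk : measurable_fun setT (fun w : measurableTypeR R * X =>
    (sdens (t / 2) w.1 * (M w.1 x w.2 * `|f w.2|))%:E).
  apply/measurable_EFinP/measurable_funM; last exact: (measurable_phd_weight x mf').
  by apply: measurableT_comp => //; exact: measurable_sdens.
have intk := integrable_phd_d k x t0 intf.
rewrite -(integral_phd_ge0 (g := fun y => `|f y|))// -ge0_integralZl//; first last.
- by move=> w _; rewrite lee_fin mulr_ge0 ?(sdens_ge0 _ (ltW t20))// mulr_ge0.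
rewrite /phd EFin_normr_Rintegral//.
have mI : measurable_fun setT (fun w : measurableTypeR R * X =>
    (sdens_d k t w.1 * (M w.1 x w.2 * f w.2))%:E).
  by have [] := integrableP _ _ _ intk.
apply: (le_trans (le_abse_integral (leb_prod m) measurableT mI)).
apply: ge0_le_integral => //.
- exact: measurableT_comp.
- exact: measurable_funeM.
- move=> w _; rewrite abse_EFin -EFinM lee_fin normrM (normrM (M _ _ _)).
  rewrite (ger0_norm (M_ge0 _ _ _)) [leRHS]mulrA ler_wpM2r ?mulr_ge0//.
  exact: HC.
Qed.

(** * The three bounds on the norms of the derivatives *)

Lemma measurable_pop_EFin (t : R) (h : X -> R) : 0 < t -> (forall y, 0 <= h y) ->
  measurable_fun setT h -> measurable_fun setT (pop t (EFin \o h)).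
Proof.
move=> t0 h0 mh; apply: measurable_pop; first exact: ltW.
  by move=> y; rewrite lee_fin.
exact/measurable_EFinP.
Qed.

Lemma pop_EFin_ge0 (t : R) (h : X -> R) x : 0 < t -> (forall y, 0 <= h y) ->
  (0 <= pop t (EFin \o h) x)%E.
Proof.
by move=> t0 h0; apply: pop_ge0; [exact: ltW|move=> y; rewrite lee_fin].
Qed.

Lemma Lnorm_phd_nonincreasing (p : \bar R) (f : X -> R) k (s t : R) :
  (1 <= p)%E -> 0 < s -> s <= t -> m.-integrable setT (EFin \o f) ->
  ('N[m]_p[EFin \o phd f k t] <= 'N[m]_p[EFin \o phd f k s])%E.
Proof.
move=> p1 s0 + intf; have [/measurable_EFinP mf _] := integrableP _ _ _ intf.
rewrite le_eqVlt => /predU1P[->//|st].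
have r0 : 0 < t - s by rewrite subr_gt0.
have mh : measurable_fun setT (fun z => `|phd f k s z|).
  by apply: measurableT_comp => //; exact: measurable_phd.
apply: (@le_trans _ _ ('N[m]_p[pop (t - s) (EFin \o (fun z => `|phd f k s z|%R))])%E).
  apply: le_Lnorm => //.
  - by apply/measurable_EFinP; exact: measurable_phd.
  - exact: measurable_pop_EFin.
  - move=> x; rewrite abse_EFin gee0_abs; last exact: pop_EFin_ge0.
    by rewrite -{1}(subrK s t); exact: phd_semigroup_le.
apply: (le_trans (pop_contraction p1 r0 _ mh)) => //.
by rewrite -[leRHS]Lnorm_abse.
Qed.

Lemma Lnorm_phd_le (p : \bar R) (f : X -> R) k : (1 <= p)%E ->
  m.-integrable setT (EFin \o f) ->
  exists2 C : R, 0 <= C & forall t : R, 0 < t ->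
    ('N[m]_p[EFin \o phd f k t] <= (C * t^-1 ^+ k)%:E * 'N[m]_p[EFin \o f])%E.
Proof.
move=> p1 intf; have [/measurable_EFinP mf _] := integrableP _ _ _ intf.
have [C C0 HC] := phd_le k intf; exists C => // t t0.
have t20 : 0 < t / 2 by rewrite divr_gt0.
set c := C * t^-1 ^+ k.
have c0 : 0 <= c by rewrite mulr_ge0// exprn_ge0// invr_ge0 ltW.
have mh : measurable_fun setT (fun z => `|f z|) by exact: measurableT_comp.
have mch : measurable_fun setT (fun z => c * `|f z|) by exact: measurable_funM.
(* The constant is moved inside P and comes out only after the contraction, from the norm of a real
   function. *)
have popZ x : pop (t / 2) (EFin \o (fun z => c * `|f z|)%R) x =
    (c%:E * pop (t / 2) (fun y => `|f y|%:E) x)%E.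
  rewrite -ge0_integralZl//; first last.
  - by move=> y _; rewrite mule_ge0 ?pker_ge0 ?lee_fin// ltW.
  - apply: emeasurable_funM; first by apply: measurable_pker => //; exact: ltW.
    exact/measurable_EFinP.
  by apply: eq_integral => y _; rewrite /= EFinM muleCA.
have c0h z : 0 <= c * `|f z| by rewrite mulr_ge0.
apply: (@le_trans _ _ ('N[m]_p[pop (t / 2) (EFin \o (fun z => c * `|f z|)%R)])%E).
  apply: le_Lnorm => //.
  - by apply/measurable_EFinP; exact: measurable_phd.
  - exact: measurable_pop_EFin.
  - move=> x; rewrite abse_EFin gee0_abs; last exact: pop_EFin_ge0.
    by rewrite popZ; exact: HC.
apply: (le_trans (pop_contraction p1 t20 c0h mch)).
rewrite LnormZ_ge0// lee_wpmul2l ?lee_fin//.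
by rewrite -[leRHS]Lnorm_abse.
Qed.

(** The intermediate point c in ]t, 2t[ of the mean value theorem depends on x, so no norm at time c
    can be taken. The derivative at c is first bounded by P_(c - t/2) applied to its absolute value
    at the fixed time t/2; then, as t/2 <= c - t/2 <= 3t/2, [le_pop_time] replaces P_(c - t/2) by 3
    P_(t/2), which is free of c. *)
Lemma Lnorm_phd_double (p : \bar R) (f : X -> R) k (t : R) : (1 <= p)%E ->
  0 < t -> m.-integrable setT (EFin \o f) ->
  ('N[m]_p[EFin \o phd f k t] <= 'N[m]_p[EFin \o phd f k (2 * t)] +
     (3 * t)%:E * 'N[m]_p[EFin \o phd f k.+1 (t / 2)])%E.
Proof.
move=> p1 t0 intf; have [/measurable_EFinP mf _] := integrableP _ _ _ intf.
have t20 : 0 < t / 2 by rewrite divr_gt0.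
have tt : t < 2 * t by rewrite mulr_natl mulr2n ltrDl.
have c0 : 0 <= 3 * t by rewrite mulr_ge0// ltW.
pose h (z : X) : R := `|phd f k.+1 (t / 2) z|.
have mh : measurable_fun setT h.
  by apply: measurableT_comp => //; exact: measurable_phd.
have mch : measurable_fun setT (fun z => 3 * t * h z) by exact: measurable_funM.
have h0 z : 0 <= h z by rewrite /h.
have c0h z : 0 <= 3 * t * h z by rewrite mulr_ge0.
have popZ x : pop (t / 2) (EFin \o (fun z => 3 * t * h z)%R) x =
    ((3 * t)%:E * pop (t / 2) (EFin \o h) x)%E.
  rewrite -ge0_integralZl//; first last.
  - by move=> y _; rewrite mule_ge0 ?pker_ge0 ?lee_fin// ltW.
  - apply: emeasurable_funM; first by apply: measurable_pker => //; exact: ltW.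
    exact/measurable_EFinP.
  by apply: eq_integral => y _; rewrite /= EFinM muleCA.
have diff x : (`|phd f k t x - phd f k (2 * t) x|%:E <=
    pop (t / 2) (EFin \o (fun z => 3 * t * h z)%R) x)%E.
  have D (y : R) : 0 < y -> is_derive y (1 : R) (fun t => phd f k t x) (phd f k.+1 y x).
    by move=> y0; exact: is_derive_phd.
  have [||c] := @MVT R (fun t => phd f k t x) (fun t => phd f k.+1 t x) t (2 * t) tt.
  - by move=> y; rewrite in_itv/= => /andP[ty _]; apply: D; exact: lt_trans ty.
  - apply: derivable_within_continuous => y; rewrite in_itv/= => /andP[ty _].
    by have [] := D y (lt_le_trans t0 ty).
  rewrite in_itv/= => /andP[tc ct]; rewrite distrC => ->.
  have -> : 2 * t - t = t by lra.
  rewrite normrM (gtr0_norm t0) mulrC EFinM popZ.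
  rewrite [(3 * t)%R]mulrC EFinM -muleA lee_wpmul2l ?lee_fin ?(ltW t0)//.
  have c2 : t / 2 <= c - t / 2 by lra.
  have c20 : 0 < c - t / 2 by apply: lt_le_trans c2.
  have -> : c = (c - t / 2) + t / 2 by rewrite subrK.
  apply: (le_trans (phd_semigroup_le _ _ c20 t20 intf)).
  apply: (le_trans (le_pop_time _ t20 c2 _ _)).
  - by move=> y; rewrite lee_fin.
  - exact/measurable_EFinP.
  rewrite lee_wpmul2r ?pop_ge0 ?(ltW t20)// lee_fin ler_pdivrMr//; lra.
have mp t' : measurable_fun setT (phd f k t') by exact: measurable_phd.
rewrite (_ : phd f k t = (phd f k (2 * t) \+ (fun x => phd f k t x - phd f k (2 * t) x))%R); last first.
  by apply/funext => x /=; rewrite addrC subrK.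
apply: (le_trans (eminkowski _ _ _ p1)) => //; first exact: measurable_funB.
rewrite leeD2l//.
apply: (@le_trans _ _ ('N[m]_p[pop (t / 2) (EFin \o (fun z => 3 * t * h z)%R)])%E).
  apply: le_Lnorm => //.
  - by apply/measurable_EFinP; exact: measurable_funB.
  - exact: measurable_pop_EFin.
  - move=> x; rewrite abse_EFin gee0_abs; last exact: pop_EFin_ge0.
    exact: diff.
apply: (le_trans (pop_contraction p1 t20 c0h mch)).
rewrite LnormZ_ge0// lee_wpmul2l ?lee_fin//.
by rewrite -[leRHS]Lnorm_abse.
Qed.

Lemma derive1n_phd0 (f : X -> R) k (t : R) x : 0 < t ->
  m.-integrable setT (EFin \o f) ->
  derive1n k (fun t => phd f 0 t x) t = phd f k t x.
Proof.
move=> t0 intf; have [/measurable_EFinP mf _] := integrableP _ _ _ intf.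
rewrite /phd (_ : (fun t => _) = (fun t => \int[leb_prod m]_w
    (sdens t w.1 * (M w.1 x w.2 * f w.2)))); last first.
  by apply/funext => u; apply: eq_Rintegral => w _; rewrite sdens_d0.
apply: (@derive1n_integral_sdens R _ _ (leb_prod m) fst
  (fun w => M w.1 x w.2 * f w.2)) => //.
- exact: measurable_phd_weight.
- by move=> a a0; exact: integrable_phd.
Qed.

End subordination.

(** * The Mehler kernel *)

Section density.
Context d (X : measurableType d) {R : realType}.
Variables (mu nu : {measure set X -> \bar R}) (w : X -> R).
Hypothesis mw : measurable_fun setT w.
Hypothesis w0 : forall x, 0 <= w x.
Hypothesis nuE : forall A, measurable A ->
  nu A = (\int[mu]_(x in A) (w x)%:E)%E.

Import HBNNSimple.

Let density_nnsfun (f : {nnsfun X >-> R}) :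
  (\int[nu]_x (f x)%:E = \int[mu]_x (f x * w x)%:E)%E.
Proof.
have mfk k : measurable (f @^-1` [set k]) by exact: measurable_funPTI.
transitivity (\sum_(k \in range f) k%:E * nu (f @^-1` [set k]))%E.
  under eq_integral do rewrite fimfunE -fsumEFin//.
  rewrite ge0_integral_fsum//; last 2 first.
  - by move=> r; exact/measurable_EFinP/measurableT_comp.
  - by move=> r x _; rewrite EFinM nnfun_muleindic_ge0.
  apply: eq_fsbigr => r _; under eq_integral do rewrite EFinM.
  have [r0|r0] := leP 0 r.
    rewrite ge0_integralZl//; last exact/measurable_EFinP/measurable_indic.
    by rewrite integral_indic// setIT.
  rewrite preimage_nnfun0// measure0 mule0; apply: integral0_eq => x _.
  by rewrite indic0 mule0.
transitivity (\int[mu]_x \sum_(k \in range f)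
    (k * \1_(f @^-1` [set k]) x)%:E * (w x)%:E)%E; last first.
  apply: eq_integral => x _; rewrite EFinM [in RHS]fimfunE -fsumEFin//.
  by rewrite ge0_mule_fsuml// => r; rewrite EFinM nnfun_muleindic_ge0.
rewrite ge0_integral_fsum//; last 2 first.
- move=> r; apply: emeasurable_funM; last exact/measurable_EFinP.
  exact/measurable_EFinP/measurableT_comp.
- by move=> r x _; rewrite mule_ge0 ?lee_fin// -lee_fin EFinM nnfun_muleindic_ge0.
apply: eq_fsbigr => r _; have [r0|r0] := leP 0 r; last first.
  rewrite preimage_nnfun0// measure0 mule0; apply/esym/integral0_eq => x _.
  by rewrite indic0 mulr0 mul0e.
rewrite nuE// integral_mkcond -ge0_integralZl//; first last.
- by move=> x _; rewrite patchE; case: ifPn => // _; rewrite lee_fin.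
- by apply/(measurable_restrictT _ _).1 => //; exact/measurable_funTS/measurable_EFinP.
apply: eq_integral => x _; rewrite patchE indicE; case: ifPn => _.
  by rewrite mulr1.
by rewrite mulr0 mul0e mule0.
Qed.

(** From nonnegative simple functions, by monotone convergence on both sides. *)
Lemma ge0_integral_density (h : X -> \bar R) : measurable_fun setT h ->
  (forall x, 0 <= h x)%E ->
  (\int[nu]_x h x = \int[mu]_x (h x * (w x)%:E))%E.
Proof.
move=> mh h0; pose g := nnsfun_approx measurableT mh.
have gh x : (g n x)%:E @[n --> \oo] --> h x by exact: cvg_nnsfun_approx.
have gn x : {homo (fun n => (g n x)%:E) : m n / (m <= n)%N >-> (m <= n)%E}.
  by move=> m n mn; rewrite lee_fin; exact/lefP/nd_nnsfun_approx.
transitivity (limn (fun n => \int[nu]_x (g n x)%:E))%E.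
  rewrite -monotone_convergence//.
  - by apply: eq_integral => x _; apply/esym/cvg_lim => //; exact: gh.
  - by move=> n; exact/measurable_EFinP.
  - by move=> n x _; rewrite lee_fin.
transitivity (limn (fun n => \int[mu]_x (g n x * w x)%:E))%E.
  by congr (limn _); apply/funext => n; exact: density_nnsfun.
rewrite -monotone_convergence//.
- apply: eq_integral => x _; apply/cvg_lim => //.
  under eq_cvg do rewrite EFinM.
  by apply: cvgeZr => //; exact: gh.
- by move=> n; apply/measurable_EFinP; exact: measurable_funM.
- by move=> n x _; rewrite lee_fin mulr_ge0.
- by move=> x _ m n mn; rewrite lee_fin ler_wpM2r// -lee_fin; exact: gn.
Qed.

Lemma Rintegral_density (h : X -> R) : measurable_fun setT h ->
  \int[nu]_x h x = \int[mu]_x (h x * w x).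
Proof.
move=> mh; rewrite /Rintegral; congr fine.
rewrite [LHS]integralE [RHS]integralE.
rewrite ge0_integral_density//; last exact/measurable_funepos/measurable_EFinP.
rewrite ge0_integral_density//; last exact/measurable_funeneg/measurable_EFinP.
congr (_ - _)%E; apply: eq_integral => x _.
- rewrite !funeposE -EFin_max -EFinM -EFin_max; congr EFin.
  by rewrite maxr_pMl// mul0r.
- rewrite !funenegE -EFinN -EFin_max -EFinM -EFinN -EFin_max; congr EFin.
  by rewrite maxr_pMl// mulNr mul0r.
Qed.

Lemma integrable_density (h : X -> R) :
  nu.-integrable setT (EFin \o h) ->
  mu.-integrable setT (fun x => (h x * w x)%:E).
Proof.
move=> /integrableP[/measurable_EFinP mh hoo]; apply/integrableP; split.
  by apply/measurable_EFinP; exact: measurable_funM.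
move: hoo; rewrite ge0_integral_density//; last first.
  by apply: measurableT_comp => //; exact/measurable_EFinP.
congr (_ < _)%E; apply: eq_integral => x _.
by rewrite /= normrM (ger0_norm (w0 x)).
Qed.

End density.

(** * Tonelli for Lebesgue measure on R^d *)

Section lebesgue_tuple.
Context {R : realType}.
Local Notation leb := (@lebesgue_measure R).

Lemma ge0_integral_lebesgue_tupleS d (F : d.+1.-tuple R -> \bar R) :
  measurable_fun setT F -> (forall y, 0 <= F y)%E ->
  (\int[lebesgue_tuple R d.+1]_y F y =
   \int[leb]_a \int[lebesgue_tuple R d]_t F (tuple_cons (a, t)))%E.
Proof.
move=> mF F0.
have mc : measurable_fun [set: measurableTypeR R * d.-tuple R] (@tuple_cons R d).
  exact: measurable_tuple_cons.
transitivity (\int[(leb \x lebesgue_tuple R d)%E]_w F (tuple_cons w))%E.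
  have H := @ge0_integral_pushforward _ _ _ _ R _ mc
    (leb \x lebesgue_tuple R d)%E setT F measurableT mF (fun y _ => F0 y).
  rewrite preimage_setT in H; rewrite -H.
  by apply: eq_measure_integral => A mA _.
rewrite (@fubini_tonelli1 _ _ (measurableTypeR R) _ R leb (lebesgue_tuple R d)
  (fun w => F (tuple_cons w)))//.
exact: measurableT_comp.
Qed.

Lemma integral_lebesgue_tuple_prod d (F : 'I_d -> R -> R) (c : 'I_d -> R) :
  (forall i, measurable_fun setT (F i)) -> (forall i x, 0 <= F i x) ->
  (forall i, \int[leb]_x (F i x)%:E = (c i)%:E)%E ->
  (\int[lebesgue_tuple R d]_y (\prod_(i < d) F i (tnth y i))%:E =
   (\prod_(i < d) c i)%:E)%E.
Proof.
elim: d F c => [|d IH] F c mF F0 Fc.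
  under eq_integral do rewrite big_ord0.
  by rewrite integral_cst//= big_ord0 mul1e; exact: diracT.
have mFt : measurable_fun setT
    (fun y : d.+1.-tuple R => (\prod_(i < d.+1) F i (tnth y i))%:E).
  apply/measurable_EFinP; apply: measurable_prod => i _.
  by apply: measurableT_comp => //; exact: measurable_tnth.
rewrite ge0_integral_lebesgue_tupleS//; last first.
  by move=> y; rewrite lee_fin prodr_ge0.
transitivity (\int[leb]_a ((F ord0 a)%:E *
    (\prod_(i < d) c (lift ord0 i))%:E))%E.
  apply: eq_integral => a _.
  rewrite -(IH (fun i => F (lift ord0 i)))// -ge0_integralZl//; first last.
  - by rewrite lee_fin.
  - by move=> y _; rewrite lee_fin prodr_ge0.
  - apply/measurable_EFinP; apply: measurable_prod => i _.
    by apply: measurableT_comp => //; exact: measurable_tnth.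
  apply: eq_integral => t _; rewrite big_ord_recl -EFinM; congr (_ * _)%:E.
  by apply: eq_bigr => i _; rewrite tnthS.
rewrite ge0_integralZr//; first last.
- rewrite lee_fin prodr_ge0// => i _; rewrite -lee_fin -Fc.
  by apply: integral_ge0 => x _; rewrite lee_fin.
- by move=> x _; rewrite lee_fin.
- by apply/measurable_EFinP; exact: mF.
by rewrite Fc -EFinM big_ord_recl.
Qed.

End lebesgue_tuple.

(** * The Mehler kernel in dimension one *)

Section mehler1.
Context {R : realType}.
Local Notation leb := (@lebesgue_measure R).
Implicit Types r a b s u : R.

Definition gauss1 b : R := (Num.sqrt pi)^-1 * expR (- b ^+ 2).

(** The normal density of mean m and variance v/2; [gauss1] is the case m = 0, v = 1. *)
Definition gauss_kernel (m v b : R) : R :=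
  (Num.sqrt (pi * v))^-1 * expR (- ((b - m) ^+ 2 / v)).

Lemma gauss_kernel_ge0 m v b : 0 <= gauss_kernel m v b.
Proof. by rewrite mulr_ge0 ?expR_ge0// invr_ge0 sqrtr_ge0. Qed.

Lemma integral_gauss_kernel (m v : R) : 0 < v ->
  (\int[leb]_b (gauss_kernel m v b)%:E = 1)%E.
Proof.
move=> v0; pose sg := Num.sqrt (v / 2).
have sg2 : sg ^+ 2 = v / 2 by rewrite sqr_sqrtr// divr_ge0// ltW.
have sg0 : sg != 0 by rewrite gt_eqF// sqrtr_gt0 divr_gt0.
rewrite -(integral_normal_pdf m sg); apply: eq_integral => b _.
rewrite normal_pdfE// /gauss_kernel /normal_peak /normal_fun sg2.
have -> : v / 2 *+ 2 = v by rewrite -mulr_natr divfK.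
have -> : v / 2 * pi *+ 2 = pi * v by rewrite -mulr_natr; field.
by rewrite mulNr.
Qed.

(* The Mehler kernel with respect to the Gaussian measure, r = exp (- s). *)
Definition mehlerq r a b : R := (Num.sqrt (1 - r ^+ 2))^-1 *
  expR ((2 * r * a * b - r ^+ 2 * (a ^+ 2 + b ^+ 2)) / (1 - r ^+ 2)).

Lemma mehlerq_ge0 r a b : 0 <= mehlerq r a b.
Proof. by rewrite mulr_ge0 ?expR_ge0// invr_ge0 sqrtr_ge0. Qed.

Lemma mehlerqC r a b : mehlerq r a b = mehlerq r b a.
Proof. by rewrite /mehlerq (addrC (a ^+ 2)) (mulrAC _ a b). Qed.

(** Times the density of gamma_1, the Mehler kernel is the Ornstein-Uhlenbeck kernel of the
    definition. This yields both its mass and its identification with T_s. *)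
Lemma mehlerq_gauss r a b : 0 < r < 1 ->
  mehlerq r a b * gauss1 b = gauss_kernel (r * a) (1 - r ^+ 2) b.
Proof.
move=> /andP[r0 r1]; have v0 : 0 < 1 - r ^+ 2 by rewrite subr_gt0 exprn_ilt1 ?ltW.
rewrite /mehlerq /gauss1 /gauss_kernel mulrACA -invfM -expRD; congr (_ * expR _).
  by rewrite sqrtrM ?pi_ge0// mulrC.
by field; rewrite gt_eqF.
Qed.

(** As a function of c the left side is Gaussian. Completing the square gives the mean and the
    variance parameter on the right; what remains is the kernel for r rho, so times add up when r
    and rho are exponentials. *)
Lemma mehlerq_comp r rho a b c : 0 < r < 1 -> 0 < rho < 1 ->
  mehlerq r a c * mehlerq rho c b * gauss1 c =
  mehlerq (r * rho) a b *
  gauss_kernel ((r * a * (1 - rho ^+ 2) + rho * b * (1 - r ^+ 2)) / (1 - (r * rho) ^+ 2))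
    ((1 - r ^+ 2) * (1 - rho ^+ 2) / (1 - (r * rho) ^+ 2)) c.
Proof.
move=> /andP[r0 r1] /andP[h0 h1].
have v0 : 0 < 1 - r ^+ 2 by rewrite subr_gt0 exprn_ilt1 ?ltW.
have w0 : 0 < 1 - rho ^+ 2 by rewrite subr_gt0 exprn_ilt1 ?ltW.
have z0 : 0 < 1 - (r * rho) ^+ 2.
  by rewrite subr_gt0 exprn_ilt1 ?mulr_ge0 ?(ltW r0) ?(ltW h0)// mulr_ilt1 ?ltW.
rewrite /mehlerq /gauss1 /gauss_kernel.
have expRM2 (p1 p2 e1 e2 : R) :
    (p1 * expR e1) * (p2 * expR e2) = (p1 * p2) * expR (e1 + e2).
  by rewrite expRD mulrACA.
rewrite !expRM2; congr (_ * expR _).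
  rewrite -!invfM; congr (_^-1).
  rewrite -mulrA [in RHS]mulrA sqrtrM ?mulr_ge0 ?pi_ge0 ?ltW//.
  rewrite -!sqrtrM ?mulr_ge0 ?pi_ge0 ?ltW//; congr Num.sqrt.
  by field; rewrite gt_eqF.
by field; rewrite !gt_eqF.
Qed.

(** The exponent equals a^2 - (a - r b)^2 / (1 - r^2), hence the bound is free of b. As 1 - r^2 <=
    1, its power -1/2 may be replaced by -1, which avoids a square root later. *)
Lemma mehlerq_le r a b : 0 < r < 1 ->
  mehlerq r a b <= expR (a ^+ 2) * (1 - r ^+ 2)^-1.
Proof.
move=> /andP[r0 r1]; have v0 : 0 < 1 - r ^+ 2 by rewrite subr_gt0 exprn_ilt1 ?ltW.
rewrite /mehlerq mulrC ler_pM ?expR_ge0 ?invr_ge0 ?sqrtr_ge0//.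
  rewrite ler_expR ler_pdivrMr// -subr_ge0.
  by rewrite (_ : _ - _ = (a - r * b) ^+ 2) ?sqr_ge0//; ring.
rewrite lef_pV2 ?posrE ?sqrtr_gt0//.
have v1 : 1 - r ^+ 2 <= 1 by rewrite gerBl sqr_ge0.
rewrite -[leLHS]sqr_sqrtr ?(ltW v0)// expr2 ler_piMl ?sqrtr_ge0//.
by rewrite -[leRHS]sqrtr1 ler_sqrt.
Qed.

End mehler1.

(** * The Mehler kernel on R^d *)

Section mehler_kernel.
Context {R : realType} (d : nat).
Local Notation leb := (@lebesgue_measure R).
Local Notation X := (d.-tuple R).
Implicit Types (x y : X) (s : R).

Lemma powR_half_sqrt (v : R) : 0 <= v ->
  v `^ (- (d%:R / 2)) = (Num.sqrt v)^-1 ^+ d.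
Proof.
move=> v0; rewrite powRN mulrC powRrM powR12_sqrt// powR_mulrn ?sqrtr_ge0//.
by rewrite exprVn.
Qed.

Lemma gauss_densityE x : gauss_density x = \prod_(i < d) gauss1 (tnth x i).
Proof.
rewrite /gauss_density /sqnorm /gauss1 big_split/= prodr_const card_ord.
by rewrite -expR_sum sumrN powR_half_sqrt ?pi_ge0.
Qed.

Lemma measurable_gauss1 : measurable_fun setT (@gauss1 R).
Proof.
apply: measurable_funM => //; apply: measurableT_comp => //.
by apply: measurableT_comp => //; exact: measurable_funX.
Qed.

Lemma gauss1_ge0 (b : R) : 0 <= gauss1 b.
Proof. by rewrite mulr_ge0 ?expR_ge0// invr_ge0 sqrtr_ge0. Qed.

Lemma measurable_gauss_kernel (m v : R) : measurable_fun setT (gauss_kernel m v).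
Proof.
apply: measurable_funM => //; apply: measurableT_comp => //.
apply: measurableT_comp => //; apply: measurable_funM => //.
by apply: measurable_funX; exact: measurable_funB.
Qed.

Lemma ge0_integral_gaussian (h : X -> \bar R) : measurable_fun setT h ->
  (forall x, 0 <= h x)%E ->
  (\int[gaussian R d]_x h x =
   \int[lebesgue_tuple R d]_x (h x * (gauss_density x)%:E))%E.
Proof.
by move=> mh h0; apply: ge0_integral_density => //;
  [exact: measurable_gauss_density|exact: gauss_density_ge0].
Qed.

Lemma gaussian_setT : gaussian R d setT = 1%E.
Proof.
rewrite /gaussian; under eq_integral do rewrite gauss_densityE.
rewrite (integral_lebesgue_tuple_prod (c := fun=> 1) (F := fun=> @gauss1 R)).
- by rewrite big1.
- by move=> i; exact: measurable_gauss1.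
- by move=> i b; exact: gauss1_ge0.
move=> i; rewrite -(integral_gauss_kernel 0 ltr01); apply: eq_integral => b _.
by rewrite /gauss1 /gauss_kernel mulr1 subr0 divr1.
Qed.

HB.instance Definition _ :=
  @Measure_isProbability.Build _ _ R (gaussian R d) gaussian_setT.

Definition mehler s x y : R :=
  \prod_(i < d) mehlerq (expR (- s)) (tnth x i) (tnth y i).

Lemma expRN_itv s : 0 < s -> 0 < expR (- s) < 1.
Proof. by move=> s0; rewrite expR_gt0/= -expR0 ltr_expR oppr_lt0. Qed.

Lemma measurable_tnth_comp d' (T : measurableType d') (a : T -> X) i :
  measurable_fun setT a -> measurable_fun setT (fun w => tnth (a w) i).
Proof.
move=> ma; apply: (@measurableT_comp _ _ _ _ _ _ (fun t : X => tnth t i)) => //.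
exact: measurable_tnth.
Qed.

Lemma measurable_mehler :
  measurable_fun setT (fun w : R * (X * X) => mehler w.1 w.2.1 w.2.2).
Proof.
have mr : measurable_fun setT (fun w : R * (X * X) => expR (- w.1)).
  by apply: measurableT_comp => //; exact: measurableT_comp.
have mv : measurable_fun setT (fun w : R * (X * X) => 1 - expR (- w.1) ^+ 2).
  by apply: measurable_funB => //; exact: measurable_funX.
apply: measurable_prod => i _.
have mx : measurable_fun setT (fun w : R * (X * X) => tnth w.2.1 i).
  by apply: measurable_tnth_comp; exact: measurableT_comp.
have my : measurable_fun setT (fun w : R * (X * X) => tnth w.2.2 i).
  by apply: measurable_tnth_comp; exact: measurableT_comp.
apply: measurable_funM.
  apply: measurable_fun_inv; apply: measurableT_comp => //.
  by apply: continuous_measurable_fun; exact: sqrt_continuous.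
apply: measurableT_comp => //; apply: measurable_funM; last exact: measurable_fun_inv.
apply: measurable_funB.
  by do 2 apply: measurable_funM => //; exact: measurable_funM.
apply: measurable_funM; first exact: measurable_funX.
by apply: measurable_funD; exact: measurable_funX.
Qed.

Lemma mehler_ge0 s x y : 0 <= mehler s x y.
Proof. by apply: prodr_ge0 => i _; exact: mehlerq_ge0. Qed.

Lemma mehlerC s x y : mehler s x y = mehler s y x.
Proof. by apply: eq_bigr => i _; exact: mehlerqC. Qed.

Lemma measurable_mehler_right s x : measurable_fun setT (mehler s x).
Proof.
by apply: (measurable_kernel_comp measurable_mehler
  (a := fun=> s) (b := fun=> x) (c := id)).
Qed.

Lemma mehler_mass s x : 0 < s ->
  (\int[gaussian R d]_y (mehler s x y)%:E = 1)%E.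
Proof.
move=> s0; rewrite ge0_integral_gaussian; first last.
- by move=> y; rewrite lee_fin mehler_ge0.
- by apply/measurable_EFinP; exact: measurable_mehler_right.
under eq_integral => y _ do rewrite -EFinM gauss_densityE -big_split/=.
have v0 : 0 < 1 - expR (- s) ^+ 2.
  by have /andP[r0 r1] := expRN_itv s0; rewrite subr_gt0 exprn_ilt1 ?ltW.
under eq_integral => y _ do
  under eq_bigr => i _ do rewrite (mehlerq_gauss _ _ (expRN_itv s0)).
rewrite (integral_lebesgue_tuple_prod (c := fun=> 1)
  (F := fun i => gauss_kernel (expR (- s) * tnth x i) (1 - expR (- s) ^+ 2))).
- by rewrite big1.
- by move=> i; exact: measurable_gauss_kernel.
- by move=> i b; exact: gauss_kernel_ge0.
- by move=> i; exact: integral_gauss_kernel.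
Qed.

Lemma mehler_comp u s x y : 0 < u -> 0 < s ->
  (\int[gaussian R d]_z (mehler u x z * mehler s z y)%:E =
   (mehler (u + s) x y)%:E)%E.
Proof.
move=> u0 s0; rewrite ge0_integral_gaussian; first last.
- by move=> z; rewrite lee_fin mulr_ge0 ?mehler_ge0.
- apply/measurable_EFinP/measurable_funM; first exact: measurable_mehler_right.
  under eq_fun do rewrite mehlerC.
  exact: measurable_mehler_right.
set r := expR (- u); set rho := expR (- s).
have r01 := expRN_itv u0; have h01 := expRN_itv s0.
have [/andP[r0 r1] /andP[h0 h1]] := (r01, h01).
have v0 : 0 < 1 - r ^+ 2 by rewrite subr_gt0 exprn_ilt1 ?ltW.
have w0 : 0 < 1 - rho ^+ 2 by rewrite subr_gt0 exprn_ilt1 ?ltW.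
have z0 : 0 < 1 - (r * rho) ^+ 2.
  by rewrite subr_gt0 exprn_ilt1 ?mulr_ge0 ?(ltW r0) ?(ltW h0)// mulr_ilt1 ?ltW.
pose mi i := (r * tnth x i * (1 - rho ^+ 2) + rho * tnth y i * (1 - r ^+ 2)) /
  (1 - (r * rho) ^+ 2).
pose vi := (1 - r ^+ 2) * (1 - rho ^+ 2) / (1 - (r * rho) ^+ 2).
transitivity (\int[lebesgue_tuple R d]_z ((mehler (u + s) x y)%:E *
    (\prod_(i < d) gauss_kernel (mi i) vi (tnth z i))%:E))%E.
  apply: eq_integral => z _; rewrite -!EFinM; congr EFin.
  rewrite gauss_densityE /mehler -!big_split/=; apply: eq_bigr => i _.
  by rewrite mehlerq_comp// opprD expRD.
rewrite ge0_integralZl//; first last.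
- by rewrite lee_fin mehler_ge0.
- by move=> z _; rewrite lee_fin prodr_ge0// => i _; exact: gauss_kernel_ge0.
- apply/measurable_EFinP; apply: measurable_prod => i _.
  apply: measurableT_comp; first exact: measurable_gauss_kernel.
  exact: measurable_tnth.
rewrite (integral_lebesgue_tuple_prod (c := fun=> 1)
  (F := fun i => gauss_kernel (mi i) vi)).
- by rewrite big1// mule1.
- by move=> i; exact: measurable_gauss_kernel.
- by move=> i b; exact: gauss_kernel_ge0.
- by move=> i; apply: integral_gauss_kernel; rewrite divr_gt0// mulr_gt0.
Qed.

Lemma mehler_bound : exists n (B : X -> R), forall s x y, 0 < s ->
  mehler s x y <= B x * (1 + s^-1) ^+ n.
Proof.
exists d, (fun x => \prod_(i < d) expR (tnth x i ^+ 2)) => s x y s0.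
have /andP[r0 r1] := expRN_itv s0.
have v0 : 0 < 1 - expR (- s) ^+ 2 by rewrite subr_gt0 exprn_ilt1 ?ltW.
(* Since exp(-2s) <= exp(-s) <= 1/(1+s), one has 1 - exp(-2s) >= s/(1+s). *)
have vs : (1 - expR (- s) ^+ 2)^-1 <= 1 + s^-1.
  have -> : 1 + s^-1 = (s / (1 + s))^-1.
    by rewrite invf_div mulrDl divff ?gt_eqF// mul1r addrC.
  rewrite lef_pV2 ?posrE ?divr_gt0// ?ltr_pwDl// ?(ltW s0)//.
  have -> : s / (1 + s) = 1 - (1 + s)^-1.
    by field; rewrite gt_eqF// ltr_pwDl// ltW.
  rewrite lerD2l lerN2 expRN.
  apply: (@le_trans _ _ (expR s)^-1).
    by rewrite expr2 ler_piMl ?invr_ge0 ?expR_ge0// -expRN ltW.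
  by rewrite lef_pV2 ?posrE ?expR_gt0 ?expR_ge1Dx// ltr_pwDl// ltW.
rewrite -[X in (1 + s^-1) ^+ X]card_ord -prodr_const -big_split/=.
apply: ler_prod => i _; rewrite mehlerq_ge0/=.
apply: le_trans (mehlerq_le _ _ (expRN_itv s0)) _.
by rewrite ler_wpM2l ?expR_ge0.
Qed.

End mehler_kernel.

(** * Identification of T_s, P_t and the derivatives of P_t *)

Section poisson_hermite_kernel.
Context {R : realType} (d : nat).
Local Notation leb := (@lebesgue_measure R).
Local Notation X := (d.-tuple R).
Variable f : X -> R.
Hypothesis intf : (gaussian R d).-integrable setT (EFin \o f).

Let mf : measurable_fun setT f.
Proof. by have [/measurable_EFinP] := integrableP _ _ _ intf. Qed.

Lemma integrable_mehler (s : R) (x : X) : 0 < s ->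
  (gaussian R d).-integrable setT (fun y => (mehler s x y * f y)%:E).
Proof.
move=> s0; have [n [B HB]] := @mehler_bound R d.
have := integrableZl measurableT (B x * (1 + s^-1) ^+ n) intf.
apply: le_integrable => //.
  apply/measurable_EFinP/measurable_funM => //; exact: measurable_mehler_right.
move=> y _; rewrite -EFinM !abse_EFin lee_fin [leLHS]normrM [leRHS]normrM ler_wpM2r//.
by rewrite ger0_norm ?mehler_ge0// (le_trans (HB _ _ y s0))// ler_norm.
Qed.

Lemma ornstein_uhlenbeckE (s : R) (x : X) : 0 < s ->
  ornstein_uhlenbeck s f x = \int[gaussian R d]_y (mehler s x y * f y).
Proof.
move=> s0; rewrite (Rintegral_density (w := @gauss_density R d)
  (mu := lebesgue_tuple R d) (@measurable_gauss_density R d) (@gauss_density_ge0 R d))//; last first.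
  by apply: measurable_funM => //; exact: measurable_mehler_right.
have /andP[r0 r1] := expRN_itv s0.
have v0 : 0 < 1 - expR (- s) ^+ 2 by rewrite subr_gt0 exprn_ilt1 ?ltW.
have r2 : expR (- (2 * s)) = expR (- s) ^+ 2.
  by rewrite -mulrN expRM_natl.
rewrite /ornstein_uhlenbeck gt_eqF// r2.
set c := pi `^ _ * _.
have E (y : X) : mehler s x y * f y * gauss_density y =
    c * (expR (- (sqdist_scaled (expR (- s)) x y / (1 - expR (- s) ^+ 2))) * f y).
  rewrite mulrAC mulrA; congr (_ * f y).
  rewrite gauss_densityE /mehler -big_split/=.
  under eq_bigr do rewrite (mehlerq_gauss _ _ (expRN_itv s0)).
  rewrite /gauss_kernel big_split/= prodr_const card_ord -expR_sum; congr (_ * expR _).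
    by rewrite /c !powR_half_sqrt ?pi_ge0 ?(ltW v0)// -exprMn -invfM sqrtrM ?pi_ge0.
  by rewrite sumrN /sqdist_scaled mulr_suml.
have c0 : c != 0.
  by rewrite mulf_neq0// gt_eqF// powR_gt0// pi_gt0.
under [RHS]eq_Rintegral do rewrite E.
rewrite RintegralZl//.
(* Pulling the constant out of the integral asks for integrability of the integrand without c; it is
   c^-1 times that of the Mehler form. *)
have := @integrable_density _ X R (lebesgue_tuple R d) (gaussian R d) _
  (@measurable_gauss_density R d)
  (@gauss_density_ge0 R d) (fun _ _ => erefl)
  (fun y => mehler s x y * f y) (integrable_mehler x s0).
move=> /(integrableZl measurableT c^-1); apply: eq_integrable => // y _.
by rewrite E -EFinM; congr EFin; rewrite mulKf.
Qed.

(** Fubini, valid at every x by [integrable_phd]. The half-line of the definition extends to the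
    whole line because [sdens] vanishes for s <= 0. *)
Lemma poisson_hermiteE (t : R) (x : X) : 0 < t ->
  poisson_hermite t f x = phd (gaussian R d) (@mehler R d) f 0 t x.
Proof.
move=> t0; rewrite /poisson_hermite gt_eqF// Rintegral_mkcond.
have I := integrable_phd (@measurable_mehler R d) (@mehler_ge0 R d)
  (@mehler_bound R d) x t0 intf.
rewrite /phd /Rintegral; congr fine.
under [RHS]eq_integral do rewrite sdens_d0.
rewrite -(integral12_prod_meas1 I); apply: eq_integral => s _.
rewrite /fubini_F /= patchE; case: ifPn => [|]; last first.
  rewrite notin_setE/= in_itv/= andbT => /negP; rewrite -leNgt => s0.
  by apply/esym/integral0_eq => y _; rewrite sdens_eq0// mul0r.
rewrite inE/= in_itv/= andbT => s0.
under [RHS]eq_integral do rewrite EFinM.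
rewrite integralZl//; last exact: integrable_mehler.
rewrite ornstein_uhlenbeckE// stable_densityE// EFinM muleC; congr (_ * _)%E.
rewrite /Rintegral fineK//; exact: integrable_fin_num (integrable_mehler x s0).
Qed.

Lemma poisson_hermite_derivE k (t : R) (x : X) : 0 < t ->
  poisson_hermite_deriv k f t x = phd (gaussian R d) (@mehler R d) f k t x.
Proof.
move=> t0; rewrite -(derive1n_phd0 (@measurable_mehler R d) (@mehler_ge0 R d)
  (@mehler_bound R d) k x t0 intf) /poisson_hermite_deriv.
elim: k t t0 => [|k IH] t t0; first exact: poisson_hermiteE.
rewrite !derive1nS !derive1E; apply: near_eq_derive => //.
by near=> u; apply: IH; near: u; exact: lt_nbhsr.
Unshelve. all: end_near. Qed.

End poisson_hermite_kernel.

(** * From the bounds on the norms to the inclusions *)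

Section power_integrals.
Context {R : realType}.
Local Notation leb := (@lebesgue_measure R).

Lemma is_derive_powR_divr (c x : R) : c != 0 -> 0 < x ->
  is_derive x (1 : R) (fun t => c^-1 * t `^ c) (x `^ (c - 1)).
Proof.
move=> c0 x0; have := is_derive1_powR c x0.
by move=> /(is_derive_scale c^-1) d; apply: is_derive_eq d _; rewrite mulKf.
Qed.

Lemma continuous_powR_gt0 (c x : R) : 0 < x -> {for x, continuous (@powR R ^~ c)}.
Proof.
move=> x0; apply: differentiable_continuous; apply/derivable1_diffP.
by apply: derivable_powR; rewrite in_itv/= x0.
Qed.

Lemma cvg_powR_addn2V (e : R) : 0 < e ->
  (n.+2%:R^-1 : R) `^ e @[n --> \oo] --> 0.
Proof.
move=> e0; apply: (@cvg_comp _ _ _ (fun n => n.+2%:R^-1) (@powR R ^~ e)); last exact: powR_cvg0 e0.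
move=> A /(@cvg_addn2V0 R) H; apply: (@filterS _ \oo _ _ _ _ H) => n /=; apply.
by rewrite invr_gt0 ltr0n.
Qed.

Lemma integral_powR_ly1 (e : R) : 0 < e ->
  (\int[leb]_(t in `]0%R, 1%R]) (t `^ (e - 1))%:E = (e^-1)%:E)%E.
Proof.
move=> e0; apply: (@ge0_FTC_exhaustion _ _ (fun t => e^-1 * t `^ e)
  (fun n => n.+2%:R^-1) (fun=> 1)).
- by move=> n; rewrite invf_lt1// ltr1n.
- move=> m n mn; apply/subsetPset => x /=; rewrite !in_itv/= => /andP[mx ->].
  by rewrite andbT (le_trans _ mx)// lef_pV2 ?posrE// ler_nat !ltnS.
- apply/seteqP; split => [x /=|x [n _] /=]; rewrite !in_itv/=; last first.
    by move=> /andP[nx ->]; rewrite andbT (lt_le_trans _ nx).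
  move=> /andP[x0 x1]; exists (Num.truncn x^-1) => //=.
  rewrite in_itv/= x1 andbT -[leRHS]invrK lef_pV2 ?posrE ?invr_gt0//.
  by rewrite ltW// (lt_le_trans (truncnS_gt _))// ler_nat.
- by move=> x _; exact: powR_ge0.
- by move=> x /=; rewrite in_itv/= => /andP[x0 _]; exact: continuous_powR_gt0.
- move=> x /=; rewrite in_itv/= => /andP[x0 _].
  by apply: is_derive_powR_divr => //; rewrite gt_eqF.
rewrite powR1 mulr1 -[X in _ --> X]subr0 -[X in _ - X](mulr0 e^-1).
by apply: cvgB; [exact: cvg_cst|apply: cvgMr; exact: cvg_powR_addn2V].
Qed.

Lemma integral_powR_1y (e : R) : 0 < e ->
  (\int[leb]_(t in `[1%R, +oo[) (t `^ (- e - 1))%:E = (e^-1)%:E)%E.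
Proof.
move=> e0; apply: (@ge0_FTC_exhaustion _ _ (fun t => (- e)^-1 * t `^ (- e))
  (fun=> 1) (fun n => n.+2%:R)).
- by move=> n; rewrite ltr1n.
- move=> m n mn; apply/subsetPset => x /=; rewrite !in_itv/= => /andP[-> mx].
  by rewrite (le_trans mx)// ler_nat !ltnS.
- apply/seteqP; split => [x /=|x [n _] /=]; rewrite !in_itv/=; last first.
    by move=> /andP[-> _].
  rewrite andbT => x1; exists (Num.truncn x) => //=.
  by rewrite in_itv/= x1 ltW// (lt_le_trans (truncnS_gt _))// ler_nat.
- by move=> x _; exact: powR_ge0.
- move=> x /=; rewrite in_itv/= andbT => x1.
  exact/continuous_powR_gt0/(lt_le_trans ltr01).
- move=> x /=; rewrite in_itv/= andbT => x1.
  by apply: is_derive_powR_divr; [rewrite oppr_eq0 gt_eqF|exact: lt_le_trans x1].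
rewrite powR1 mulr1 -[X in _ --> X]add0r -[X in _ --> X + _](mulr0 (- e)^-1).
rewrite (_ : e^-1 = - (- e)^-1); last by rewrite invrN opprK.
apply: cvgB; [apply: cvgMr|exact: cvg_cst].
have := cvg_powR_addn2V e0.
by under eq_cvg do rewrite -powR_inv1 ?ler0n// -powRrM mulN1r.
Qed.

Lemma ge0_le_integral_lty d (T : measurableType d)
    (mu : {measure set T -> \bar R}) (D : set T) (f g : T -> R) (c : R) :
  measurable D -> measurable_fun D f -> measurable_fun D g ->
  (forall x, D x -> 0 <= f x) -> (forall x, D x -> 0 <= g x) -> 0 <= c ->
  (forall x, D x -> f x <= c * g x) ->
  (\int[mu]_(x in D) (g x)%:E < +oo)%E -> (\int[mu]_(x in D) (f x)%:E < +oo)%E.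
Proof.
move=> mD mf mg f0 g0 c0 fg goo.
apply: (@le_lt_trans _ _ (\int[mu]_(x in D) (c%:E * (g x)%:E))%E).
  apply: ge0_le_integral => //.
  - exact/measurable_EFinP.
  - by apply/measurable_EFinP; exact: measurable_funM.
rewrite ge0_integralZl_EFin//; last exact/measurable_EFinP.
by rewrite lte_mul_pinfty.
Qed.

End power_integrals.

(** * Inclusions for an abstract family of norms *)

Section lipschitz_scale.
Context {R : realType}.
Local Notation leb := (@lebesgue_measure R).
Variable N : nat -> R -> \bar R.

(* besov_cond a p q f is scale_cond a q for N k := poisson_hermite_deriv_norm p k f. *)
Definition scale_cond (a : R) (q : \bar R) : Prop :=
  let k := besov_order a in
  match q with
  | q'%:E =>
    ((\int[leb]_(t in `]0%R, +oo[)
       (((t `^ (k%:R - a))%:E * N k t) `^ q' * (t^-1)%:E)) `^ q'^-1 < +oo)%E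
  | +oo%E => exists A : R, forall t : R, 0 < t ->
    (N k t <= (A * t `^ (- k%:R + a))%:E)%E
  | -oo%E => False
  end.

Hypothesis N_ge0 : forall k t, (0 <= N k t)%E.
Hypothesis N_noninc : forall k (s t : R), 0 < s -> s <= t -> (N k t <= N k s)%E.
Hypothesis N_le : forall k, exists C : R, forall t : R, 0 < t ->
  (N k t <= (C * t^-1 ^+ k)%:E)%E.
Hypothesis N_double : forall k (t : R), 0 < t ->
  (N k t <= N k (2 * t) + (3 * t)%:E * N k.+1 (t / 2))%E.

Let n k t := fine (N k t).

Let nE k (t : R) : 0 < t -> N k t = (n k t)%:E.
Proof.
move=> t0; have [C HC] := N_le k.
by rewrite /n fineK// ge0_fin_numE// (le_lt_trans (HC t t0))// ltry.
Qed.

Let n_ge0 k t : 0 <= n k t. Proof. exact: fine_ge0. Qed.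

Let n_noninc k (s t : R) : 0 < s -> s <= t -> n k t <= n k s.
Proof.
by move=> s0 st; rewrite -lee_fin -!nE ?N_noninc// (lt_le_trans s0).
Qed.

Let n_le k : exists2 C : R, 0 <= C & forall t : R, 0 < t -> n k t <= C * t^-1 ^+ k.
Proof.
have [C HC] := N_le k; exists (Num.max C 0); first by rewrite le_max lexx orbT.
move=> t t0; rewrite -lee_fin -nE// (le_trans (HC t t0))// lee_fin.
by rewrite ler_wpM2r ?le_max ?lexx// exprn_ge0// invr_ge0 ltW.
Qed.

Let n_double k (t : R) : 0 < t -> n k t <= n k (2 * t) + 3 * t * n k.+1 (t / 2).
Proof.
move=> t0; rewrite -lee_fin EFinD EFinM -!nE ?divr_gt0 ?mulr_gt0//.
exact: N_double.
Qed.

(** By monotonicity the preimages of half-lines are intervals. *)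
Let measurable_n k : measurable_fun (`]0, +oo[%classic : set R) (n k).
Proof.
apply: (measurability (@RGenCInfty.G R)) => [|/= _ [_] [r] -> <-].
  exact: RGenCInfty.measurableE.
apply: is_interval_measurable => s t/=.
rewrite !in_itv/= !andbT => -[s0 rs] [t0 rt] u /andP[su ut].
rewrite in_itv/= !andbT; split; first exact: lt_le_trans su.
by rewrite in_itv/= andbT (le_trans rt)// n_noninc// (lt_le_trans s0).
Qed.

Let phi k (a q t : R) := (t `^ (k%:R - a) * n k t) `^ q * t^-1.

Let phi_ge0 k a q (t : R) : 0 < t -> 0 <= phi k a q t.
Proof. by move=> t0; rewrite mulr_ge0 ?powR_ge0// invr_ge0 ltW. Qed.

Let measurable_phi k a q : measurable_fun (`]0, +oo[%classic : set R) (phi k a q).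
Proof.
apply: measurable_funM; last first.
  apply: open_continuous_measurable_fun => // x; rewrite inE/= in_itv/= andbT.
  by move=> x0; apply: inv_continuous; rewrite gt_eqF.
apply: (@measurableT_comp _ _ _ _ _ _ (@powR R ^~ q)) => //.
apply: measurable_funM => //; apply: measurable_funTS.
exact: measurable_powR.
Qed.

Let scale_condE (a q : R) : 0 < q ->
  scale_cond a q%:E <->
  (\int[leb]_(t in `]0%R, +oo[) (phi (besov_order a) a q t)%:E < +oo)%E.
Proof.
move=> q0; rewrite /scale_cond.
have -> : (\int[leb]_(t in `]0%R, +oo[)
  (((t `^ ((besov_order a)%:R - a))%:E * N (besov_order a) t) `^ q * (t^-1)%:E) =
  \int[leb]_(t in `]0%R, +oo[) (phi (besov_order a) a q t)%:E)%E.
  apply: eq_integral => t; rewrite inE/= in_itv/= andbT => t0.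
  by rewrite nE// -EFinM poweR_EFin -EFinM.
split; last by move=> ?; rewrite poweR_lty.
by apply: lty_poweRy; rewrite invr_eq0 gt_eqF.
Qed.

(** For s in [t/2, t] one has [n k s >= n k t], and s^(k-a) >= (t/2)^(k-a) because k > a. So this
    interval alone contributes at least ((t/2)^(k-a) n k t)^q / 2 to the integral; solving for
    [n k t] gives the constant. *)
Let sup_bound (a : R) (q : \bar R) : 0 <= a -> (1 <= q)%E -> scale_cond a q ->
  exists2 A : R, 0 <= A & forall t : R, 0 < t ->
    n (besov_order a) t <= A * t `^ (- (besov_order a)%:R + a).
Proof.
move=> a0; case: q => [q| |//]; last first.
  move=> _ [A HA]; exists (Num.max A 0); first by rewrite le_max lexx orbT.
  move=> t t0; rewrite -lee_fin -nE// (le_trans (HA t t0))// lee_fin.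
  by rewrite ler_wpM2r ?powR_ge0// le_max lexx.
rewrite lee_fin => q1; have q0 : 0 < q := lt_le_trans ltr01 q1.
move=> /(scale_condE a q0).
set k := besov_order a; set I := (\int[leb]_(_ in _) _)%E => Ioo.
have I0 : (0 <= I)%E.
  apply: integral_ge0 => t /=; rewrite in_itv/= andbT lee_fin.
  exact: phi_ge0.
pose i := fine I; have i0 : 0 <= i by rewrite fine_ge0.
have IE : I = i%:E by rewrite fineK// ge0_fin_numE.
pose b := k%:R - a.
exists ((2 * i) `^ q^-1 * 2 `^ b); first by rewrite mulr_ge0 ?powR_ge0.
move=> t t0; have t20 : 0 < t / 2 by rewrite divr_gt0.
have t2t : t / 2 < t by rewrite ltr_pdivrMr// ltr_pMr// ltr1n.
pose c := ((t / 2) `^ b * n k t) `^ q * t^-1.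
have c0 : 0 <= c by rewrite mulr_ge0 ?powR_ge0// invr_ge0 ltW.
have ci : c * (t / 2) <= i.
  rewrite -lee_fin -IE.
  have -> : (c * (t / 2))%:E = (\int[leb]_(s in `[(t / 2)%R, t]) c%:E)%E.
    rewrite integral_cst//= lebesgue_measure_itv/= lte_fin t2t -EFinD -EFinM.
    by congr EFin; lra.
  have sub : `[t / 2, t]%classic `<=` (`]0, +oo[%classic : set R).
    move=> s /=; rewrite !in_itv/= andbT => /andP[ts _].
    exact: lt_le_trans ts.
  apply: (@le_trans _ _ (\int[leb]_(s in `[(t / 2)%R, t]) (phi k a q s)%:E)%E).
    apply: ge0_le_integral => //.
    - by apply/measurable_EFinP; apply: measurable_funS (measurable_phi k a q).
    - move=> s /=; rewrite in_itv/= => /andP[ts st]; rewrite lee_fin.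
      have s0 := lt_le_trans t20 ts.
      rewrite ler_pM ?powR_ge0 ?invr_ge0 ?(ltW t0)//; last by rewrite lef_pV2.
      rewrite ge0_ler_powR ?(ltW q0) ?nnegrE ?mulr_ge0 ?powR_ge0//.
      rewrite ler_pM ?powR_ge0//; last exact: n_noninc.
      by rewrite ge0_ler_powR ?nnegrE ?(ltW s0) ?(ltW t20)// subr_ge0 ltW// besov_orderP.
  apply: ge0_subset_integral => //.
    by apply/measurable_EFinP; exact: measurable_phi.
  by move=> s /=; rewrite in_itv/= andbT lee_fin; exact: phi_ge0.
have : ((t / 2) `^ b * n k t) `^ q <= 2 * i.
  rewrite (_ : _ `^ q = 2 * (c * (t / 2))); first by rewrite ler_wpM2l.
  by rewrite /c; field; rewrite gt_eqF.
move=> /(ge0_ler_powR (r := q^-1)).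
rewrite invr_ge0 (ltW q0) !nnegrE powR_ge0 mulr_ge0// => /(_ isT isT isT).
rewrite -powRrM divff ?gt_eqF// powRr1 ?mulr_ge0 ?powR_ge0//.
move=> h; have tb0 : 0 < (t / 2) `^ b by rewrite powR_gt0.
rewrite -(ler_pM2l tb0) (le_trans h)// le_eqVlt; apply/orP; left; apply/eqP.
have E2 : 2 `^ b * (t / 2) `^ b = t `^ b.
  by rewrite -powRM ?(ltW t20)// mulrC divfK.
have E1 : t `^ b * t `^ (- k%:R + a) = 1.
  rewrite -powRD; last by rewrite (gt_eqF t0) implybT.
  by rewrite (_ : b + _ = 0) ?powRr0// /b; ring.
transitivity ((2 * i) `^ q^-1 * ((2 `^ b * (t / 2) `^ b) * t `^ (- k%:R + a))).
  by rewrite E2 E1 mulr1.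
ring.
Qed.

(** With y = t^(k-a) n k t, [sup_bound] says y <= A, whence y^q2 <= A^(q2 - q1) y^q1. For infinite
    q2 the bound itself is the claim. *)
Let scale_cond_le (a : R) (q1 q2 : \bar R) : 0 <= a -> (1 <= q1)%E ->
  (q1 <= q2)%E -> scale_cond a q1 -> scale_cond a q2.
Proof.
move=> a0 q11 q12 h; have [A A0 HA] := sup_bound a0 q11 h.
case: q2 q12 => [q2| |] q12; last 2 first.
- by exists A => t t0; rewrite nE// lee_fin; exact: HA.
- by have := le_trans q11 q12.
case: q1 q11 q12 h => [q1| |] //.
rewrite !lee_fin => q11 q12.
have q10 := lt_le_trans ltr01 q11; have q20 := lt_le_trans q10 q12.
move=> /(scale_condE a q10) h; apply/(scale_condE a q20); move: h.
apply: (@ge0_le_integral_lty _ _ _ _ _ _ _ (A `^ (q2 - q1))) => //.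
- exact: measurable_phi.
- exact: measurable_phi.
- by move=> t /=; rewrite in_itv/= andbT; exact: phi_ge0.
- by move=> t /=; rewrite in_itv/= andbT; exact: phi_ge0.
- exact: powR_ge0.
move=> t /=; rewrite in_itv/= andbT => t0.
rewrite /phi mulrA ler_wpM2r ?invr_ge0 ?(ltW t0)//.
set y := _ * n _ t; have y0 : 0 <= y by rewrite mulr_ge0 ?powR_ge0.
have yA : y <= A.
  rewrite /y (le_trans (ler_wpM2l (powR_ge0 _ _) (HA t t0)))// mulrCA.
  rewrite -powRD; last by rewrite (gt_eqF t0) implybT.
  rewrite (_ : _ - a + _ = 0); first by rewrite powRr0 mulr1.
  ring.
have -> : y `^ q2 = y `^ (q2 - q1) * y `^ q1.
  by rewrite -powRD subrK// (gt_eqF q20).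
by rewrite ler_wpM2r ?powR_ge0// ge0_ler_powR ?nnegrE ?subr_ge0.
Qed.

(** Restricted to t <= 1, where lowering an exponent increases the power; this allows [b] to be
    chosen below the smoothness at hand. *)
Let decay (b : R) j :=
  exists2 C : R, 0 <= C & forall t : R, 0 < t -> t <= 1 ->
    n j t <= C * t `^ (- j%:R + b).

(* Iterating N_double along dyadic scales gives a geometric series of ratio
   2^(b - j) < 1. *)
Let decay_pred (b : R) j : b < j%:R -> decay b j.+1 -> decay b j.
Proof.
move=> bj [A A0 HA]; pose l : R := 2 `^ (- j%:R + b).
have e0 : - j%:R + b <= 0 by rewrite addrC subr_le0 ltW.
have l1 : l < 1.
  rewrite /l (_ : - j%:R + b = - (j%:R - b)); last by ring.
  rewrite powRN invf_lt1 ?powR_gt0// [ltLHS](_ : 1 = 1 `^ (j%:R - b)).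
    by rewrite gt0_ltr_powR ?subr_gt0 ?nnegrE ?ltr1n.
  by rewrite powR1.
(* The last term of [n_double], with the bound for j+1 at t/2, is 3 t A (t/2)^(b-j-1) = D
   t^(b-j). *)
pose D : R := 3 * A * 2 `^ (j.+1%:R - b).
have D0 : 0 <= D by rewrite !mulr_ge0 ?powR_ge0.
(* The term [n j 2^-1] settles t in ]1/2, 1], and D / (1 - l) makes E stable under E l + D <= E,
   that is, under one doubling step. *)
pose E := n j 2^-1 + D / (1 - l).
have E0 : 0 <= E by rewrite addr_ge0// divr_ge0// subr_ge0 ltW.
have ED : E * l + D <= E.
  rewrite -lerBrDl -[X in X - _]mulr1 -mulrBr /E mulrDl divfK ?subr_eq0 ?gt_eqF//.
  by rewrite lerDr mulr_ge0// subr_ge0 ltW.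
have top (t : R) : t <= 1 -> 2^-1 < t -> n j t <= E * t `^ (- j%:R + b).
  move=> t1 t2; have t0 : 0 < t by apply: lt_trans t2; rewrite invr_gt0.
  rewrite (@le_trans _ _ E)//.
    rewrite (le_trans (n_noninc _ _ (ltW t2))) ?invr_gt0// lerDl.
    by rewrite divr_ge0// subr_ge0 ltW.
  by rewrite ler_peMr// -[leLHS](powRr0 t) ger_powR// t0 t1.
exists E => // t t0 t1.
(* The induction is on a number m of doublings that bring t to at least 1. *)
have [m] : exists m, 1 <= t * 2 ^+ m.
  exists (Num.truncn t^-1).+1; rewrite mulrC -ler_pdivrMr// mul1r.
  rewrite ltW// (lt_le_trans (truncnS_gt _))// -natrX ler_nat ltnW//.
  exact: ltn_expl.
elim: m t t0 t1 => [|m IH] t t0 t1 tm.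
  apply: top => //; rewrite expr0 mulr1 in tm; apply: lt_le_trans tm.
  by rewrite invf_lt1// ltr1n.
have [t2|t2] := ltP 2^-1 t; first exact: top.
rewrite (le_trans (n_double j t0))// (le_trans _ (ler_wpM2r (powR_ge0 _ _) ED))//.
rewrite [leRHS]mulrDl lerD//.
  rewrite -mulrA -powRM ?(ltW t0)// IH ?mulr_gt0//.
    by rewrite mulrC -ler_pdivlMr// div1r.
  by rewrite mulrAC -exprS mulrC.
have t20 : 0 < t / 2 by rewrite divr_gt0.
have t21 : t / 2 <= 1 by rewrite ler_pdivrMr// mul1r (le_trans t1)// ler1n.
rewrite (le_trans (ler_wpM2l _ (HA _ t20 t21))) ?mulr_ge0 ?(ltW t0)//.
rewrite powRM ?(ltW t0)// -(@powR_inv1 _ 2)// -powRrM mulN1r.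
rewrite (_ : - j%:R + b = 1 + (- j.+1%:R + b)); last by rewrite -natr1; ring.
rewrite [in leRHS]powRD ?(gt_eqF t0) ?implybT// powRr1 ?(ltW t0)// /D.
rewrite opprD opprK le_eqVlt; apply/orP; left; apply/eqP; ring.
Qed.

Let decay_le (b : R) i j : b < j%:R -> (j <= i)%N -> decay b i -> decay b j.
Proof.
move=> bj /subnKC <-; elim: (i - j)%N => [|m IH]; first by rewrite addn0.
rewrite addnS => /decay_pred h; apply/IH/h/(lt_le_trans bj).
by rewrite ler_nat leq_addr.
Qed.

Let scale_cond_decay (a b : R) q : 0 <= a -> (1 <= q)%E -> b <= a ->
  scale_cond a q -> decay b (besov_order a).
Proof.
move=> a0 q1 ba /(sup_bound a0 q1)[A A0 HA]; exists A => // t t0 t1.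
by rewrite (le_trans (HA t t0))// ler_wpM2l// ger_powR ?t0// lerD2l.
Qed.

(** Two decay rates are used: exponent b > a2 on t <= 1 and exponent 0 < a2 on t > 1, so the powers
    in the integrals are (b - a2) q - 1 near 0 and -a2 q - 1 near infinity. *)
Let scale_cond_lt (a1 a2 : R) (q1 q2 : \bar R) : 0 < a2 -> a2 < a1 ->
  (1 <= q1)%E -> (1 <= q2)%E -> scale_cond a1 q1 -> scale_cond a2 q2.
Proof.
move=> a20 a21 q11 q21 h; have a10 := lt_trans a20 a21.
pose k := besov_order a2; have a2k : a2 < k%:R by rewrite besov_orderP ?ltW.
(* [b < k] is what lets the order of derivation descend to k, [b <= a1] is what the hypothesis
   provides, and [a2 < b] gives integrability at 0. *)
have [b a2b [ba1 bk]] : exists2 b : R, a2 < b & b <= a1 /\ b < k%:R.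
  exists ((a2 + Num.min a1 k%:R) / 2).
    by rewrite midf_lt// lt_min a21.
  by split; [rewrite ltW//|]; rewrite (@lt_le_trans _ _ (Num.min a1 k%:R))
    ?midf_lt ?lt_min ?a21// ge_min lexx ?orbT.
have [C C0 HC] : decay b k.
  apply: (@decay_le _ (besov_order a1)) => //.
    by rewrite -besov_orderP ?(ltW a20)// (lt_trans a21)// besov_orderP ?(ltW a10).
  exact: scale_cond_decay (ltW a10) q11 ba1 h.
have [B B0 HB0] := n_le k.
have HB (t : R) : 0 < t -> n k t <= B * t `^ (- k%:R + 0).
  by move=> t0; rewrite addr0 powR_invn ?(ltW t0)// -exprVn; exact: HB0.
case: q2 q21 => [q| |//] qge1; last first.
  exists (Num.max B C) => t t0; rewrite nE// lee_fin.
  have [t1|t1] := leP t 1.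
    rewrite (le_trans (HC t t0 t1))// ler_pM ?powR_ge0 ?le_max ?lexx ?orbT//.
    by rewrite ger_powR ?t0// lerD2l ltW.
  rewrite (le_trans (HB t t0))// ler_pM ?powR_ge0 ?le_max ?lexx//.
  by rewrite ler_powR ?(ltW t1)// lerD2l ltW.
rewrite lee_fin in qge1; have q0 : 0 < q := lt_le_trans ltr01 qge1.
apply/(scale_condE a2 q0); rewrite -/k.
(* Common to both ranges: e = b with constant C for t <= 1, e = 0 with constant B for t > 1. *)
have phi_le (c e t : R) : 0 <= c -> 0 < t -> n k t <= c * t `^ (- k%:R + e) ->
    phi k a2 q t <= c `^ q * t `^ ((e - a2) * q - 1).
  move=> c0 t0 tc; have tn0 : t != 0 by rewrite gt_eqF.
  rewrite powRD ?tn0 ?implybT// powR_inv1 ?(ltW t0)// mulrA.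
  rewrite ler_wpM2r ?invr_ge0 ?(ltW t0)// powRrM -powRM ?powR_ge0//.
  rewrite ge0_ler_powR ?(ltW q0) ?nnegrE ?mulr_ge0 ?powR_ge0//.
  rewrite (le_trans (ler_wpM2l (powR_ge0 _ _) tc))// mulrCA -powRD ?tn0 ?implybT//.
  by rewrite (_ : _ - a2 + _ = e - a2)//; ring.
have D01 : `]0, +oo[%classic = `]0, 1] `|` `]1, +oo[ :> set R.
  apply/seteqP; split => t /=; rewrite !in_itv/= !andbT.
    by move=> ->; have [|] := leP t 1; [left|right].
  by move=> [/andP[]//|]; exact: lt_trans.
have mphi D : D `<=` (`]0, +oo[%classic : set R) ->
    measurable_fun D (phi k a2 q).
  by move=> sD; apply: measurable_funS sD (measurable_phi k a2 q).
have phi0 (t : R) : `]0, +oo[%classic t -> (0 <= (phi k a2 q t)%:E)%E.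
  by rewrite /= in_itv/= andbT lee_fin; exact: phi_ge0.
rewrite D01 ge0_integral_setU//=; last 3 first.
- by apply/measurable_EFinP; rewrite -D01; exact: mphi.
- by move=> t t01; apply: phi0; rewrite D01.
- apply/disj_setPS => t /=; rewrite !in_itv/= andbT => -[/andP[_ t1]].
  by rewrite ltNge t1.
have mpow (D : set R) r : measurable_fun D (@powR R ^~ r).
  by apply: measurable_funTS; exact: measurable_powR.
rewrite lte_add_pinfty//.
  apply: (@ge0_le_integral_lty _ _ (measurableTypeR R) _ _ _
    (fun t : R => t `^ ((b - a2) * q - 1)) (C `^ q)) => //.
  - by apply: mphi; rewrite D01; exact: subsetUl.
  - exact: mpow.
  - by move=> t t01; rewrite -lee_fin phi0// D01; left.
  - by move=> t _; exact: powR_ge0.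
  - exact: powR_ge0.
  - move=> t /=; rewrite in_itv/= => /andP[t0 t1].
    by apply: phi_le => //; exact: HC.
  by rewrite integral_powR_ly1 ?ltry// mulr_gt0// subr_gt0.
apply: (@ge0_le_integral_lty _ _ (measurableTypeR R) _ _ _
  (fun t : R => t `^ ((0 - a2) * q - 1)) (B `^ q)) => //.
- by apply: mphi; rewrite D01; exact: subsetUr.
- exact: mpow.
- by move=> t t01; rewrite -lee_fin phi0// D01; right.
- by move=> t _; exact: powR_ge0.
- exact: powR_ge0.
- move=> t /=; rewrite in_itv/= andbT => t1.
  have t0 := lt_trans ltr01 t1.
  by apply: phi_le => //; exact: HB.
apply: (@le_lt_trans _ _
  (\int[leb]_(t in `[1%R, +oo[) (t `^ ((0 - a2) * q - 1))%:E)%E).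
  apply: ge0_subset_integral => //.
  - by apply/measurable_EFinP; exact: mpow.
  - by move=> t _; rewrite lee_fin powR_ge0.
  - by apply: subset_itvr; rewrite bnd_simp.
by rewrite sub0r mulNr integral_powR_1y ?ltry// mulr_gt0.
Qed.

Lemma scale_cond_incl (a1 a2 : R) (q1 q2 : \bar R) :
  (1 <= q1)%E -> (1 <= q2)%E -> 0 <= a1 ->
  (a2 < a1 /\ 0 < a2) \/ (a1 = a2 /\ (q1 <= q2)%E) ->
  scale_cond a1 q1 -> scale_cond a2 q2.
Proof.
move=> q11 q21 a10 [[a21 a20]|[<- q12]]; first exact: scale_cond_lt.
exact: scale_cond_le.
Qed.

End lipschitz_scale.

Theorem proposition2p1 (R : realType) (d : nat) (p q1 q2 : \bar R)
    (alpha1 alpha2 : R)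
    (hp : (1 <= p)%E) (hq1 : (1 <= q1)%E) (hq2 : (1 <= q2)%E)
    (ha1 : 0 <= alpha1) (ha2 : 0 <= alpha2)
    (h : (alpha2 < alpha1 /\ 0 < alpha2) \/
         (alpha1 = alpha2 /\ (q1 <= q2)%E)) :
  besov d alpha1 p q1 `<=` besov d alpha2 p q2.
Proof.
move=> f [fp fq]; split => //.
(* As gamma_d is finite, L^p is contained in L^1, where the whole theory of P_t takes place. *)
have intf : (gaussian R d).-integrable setT (EFin \o f).
  apply/Lfun1_integrable; apply: Lfun_subset fp => //.
  exact: (fin_num_measure (gaussian R d)).
have fpE : ('N[gaussian R d]_p[EFin \o f])%E \is a fin_num.
  rewrite ge0_fin_numE ?Lnorm_ge0//.
  by move: (sub_Lfun_finLfun fp); rewrite inE.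
have NE k (t : R) : 0 < t -> poisson_hermite_deriv_norm p k f t =
    ('N[gaussian R d]_p[EFin \o phd (gaussian R d) (@mehler R d) f k t])%E.
  move=> t0; apply: eq_Lnorm => x /=.
  by rewrite poisson_hermite_derivE.
(* [besov_cond] is convertible to [scale_cond] for this family of norms, so [fq] applies as it
   stands. *)
apply: (@scale_cond_incl _ (fun k => poisson_hermite_deriv_norm p k f))
  fq => // [k t|k s t s0 st|k|k t t0].
- exact: Lnorm_ge0.
- rewrite !NE//; last exact: lt_le_trans st.
  apply: Lnorm_phd_nonincreasing => //.
  + exact: measurable_mehler.
  + exact: mehler_ge0.
  + exact: mehlerC.
  + exact: mehler_mass.
  + exact: mehler_comp.
  + exact: mehler_bound.
- have [C C0 HC] := Lnorm_phd_le (@measurable_mehler R d) (@mehler_ge0 R d)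
    (@mehlerC R d) (@mehler_mass R d) (@mehler_bound R d) k hp intf.
  exists (C * fine 'N[gaussian R d]_p[EFin \o f]) => t t0.
  by rewrite NE// (le_trans (HC t t0))// mulrAC [leRHS]EFinM fineK.
- rewrite !NE ?mulr_gt0 ?divr_gt0//.
  exact: (Lnorm_phd_double (@measurable_mehler R d) (@mehler_ge0 R d)
    (@mehlerC R d) (@mehler_mass R d) (@mehler_comp R d) (@mehler_bound R d)).
Qed.
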